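(* Let $X$ and $Y$ be Banach spaces, let $K_1$ be a cone in $X$, let $U$ and $V$ be bounded and relatively open subsets of $K_1$ such that $0\in V\subset\overline{V}\subset U$, and let $D$ be a non-empty closed convex subset of $Y$. Assume that $T=(T_1,T_2):(\overline{U}\setminus V)\times D\rightarrow K_1\times D$ is a compact map and that there exists $h\in K_1\setminus\{0\}$ such that at least one of the following conditions holds for all $u=(u_1,u_2)\in(\overline{U}\setminus V)\times D$: (a) $T_1(u)+\mu h\neq u_1$ if $u_1\in\partial V$ and $\mu>0$, and $T_1(u)\neq\lambda u_1$ if $u_1\in\partial U$ and $\lambda>1$; or (b) $T_1(u)\neq\lambda u_1$ if $u_1\in\partial V$ and $\lambda>1$, and $T_1(u)+\mu h\neq u_1$ if $u_1\in\partial U$ and $\mu>0$. Then $T$ has at least one fixed point $u=(u_1,u_2)\in K_1\times D$ with $u_1\in\overline{U}\setminus V$.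
   Context: Banach spaces are real. A closed convex subset $K$ of a normed linear space $X$ is a cone if $\lambda u\in K$ for every $u\in K$ and all $\lambda\ge 0$, and $K\cap(-K)=\{0\}$. A map is compact if it is continuous and its image (the image of its whole domain) is relatively compact. Closures and boundaries ($\overline{U}$, $\overline{V}$, $\partial U$, $\partial V$) are taken with respect to the relative topology of $K_1$. *)

(* Defs.v *)
From HB Require Import structures.
From mathcomp Require Import all_boot all_order all_algebra.
From mathcomp Require Import all_classical all_reals all_analysis.

Set Implicit Arguments.
Unset Strict Implicit.
Unset Printing Implicit Defensive.

Import Order.TTheory GRing.Theory Num.Theory.
Import numFieldNormedType.Exports.

Local Open Scope classical_set_scope.
Local Open Scope ring_scope.

Definition is_cone (R : realType) (X : normedModType R) (K : set X) : Prop :=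
  [/\ closed K,
      convex_set K,
      forall (u : X) (lambda : R), K u -> 0 <= lambda -> K (lambda *: u) &
      K `&` [set - u | u in K] = [set 0]].

(* The library type [subspace K] has the same points as the ambient space: it
   carries the relative topology on K and the discrete topology off K, so for
   subsets of K the three notions below are those of the relative topology. *)

Definition rel_open (T : topologicalType) (K U : set T) : Prop :=
  U `<=` K /\ open (U : set (subspace K)).

Definition rel_closure (T : topologicalType) (K U : set T) : set T :=
  closure (U : set (subspace K)).

Definition rel_boundary (T : topologicalType) (K U : set T) : set T :=
  rel_closure K U `\` interior (U : set (subspace K)).

(* The values of f outside A are irrelevant. *)
Definition compact_map (S T : topologicalType) (A : set S) (B : set T)
    (f : S -> T) : Prop :=
  [/\ set_fun A B f, {within A, continuous f} & precompact (f @` A)].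

(* Main.v *)
(** Assume that T has no fixed point.  By compactness every map close enough
    to T is also fixed point free and satisfies both boundary conditions
    strictly, so T may be replaced by a finite-rank approximation, which
    Tietze's theorem extends to all of X * Y with values in K1 * D.  For a
    finite-rank map the index-theoretic argument is elementary: the solutions
    of the homotopy attached to a boundary condition form a closed set that
    avoids the boundary, so a Urysohn function can be used as homotopy
    parameter, and the resulting finite-rank self-map of X * Y has no fixed
    point, against Brouwer.  The expansive case (b) is turned into a compressive
    one by the inversion v |-> v / |v|^2 of the cone.  Brouwer's theorem itself
    comes from a lemma of Scarf on finitely many linear orders, proved by a
    doors-and-rooms parity count. *)

(* Every deformation multiplies the first component by a nonnegative scalar or adds a nonnegative
   multiple of [h], so its values stay in the cone, while the second component always takes values
   in [D]. A fixed point of a map defined on all of [X * Y] therefore lies in the cone times [D]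
   automatically. For the same reason Tietze's theorem is applied to the real coefficients of a
   convex combination and not to the vector-valued map. The translation condition empties the inner
   region of a compression: the last translate is chosen longer than any solution there could allow.
   The radial condition contracts the outer region to 0, which is not in it. In the expansive case
   the same recipe breaks down: contracting on [V] creates a fixed point near 0, and Brouwer's
   theorem may return just that one. Inversion sends 0 to infinity, so that the contracted region
   becomes the outer one and the translated region surrounds 0. The conditions are given only for
   [mu > 0] and [lambda > 1]; the borderline values are fixed points of [T], excluded by
   contradiction, and this is what makes both conditions stable under small perturbations. *)
Require Import Defs.
From HB Require Import structures.
From mathcomp Require Import all_boot all_order all_algebra zify lra.

Set Implicit Arguments.
Unset Strict Implicit.
Unset Printing Implicit Defensive.

(** * Scarf's lemma *)

(* [r i] ranks the points of [W] for the [i]-th linear order, and [s i] is a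
   slack point: the least one for [r i] and, for every other order, above all
   genuine points.  With slacks, Scarf's pairs (set of points, set of indices)
   become plain subsets of [W]: a room is a dominant set with as many elements
   as [I], a door is a room minus one element. *)
Section Scarf.
Variables (I W : finType) (r : I -> W -> nat) (s : I -> W) (c : W -> I).
Hypothesis r_inj : forall i, injective (r i).
Hypothesis s_min : forall i w, r i (s i) <= r i w.
Hypothesis s_max :
  forall i j w, j != i -> (forall k, w != s k) -> r i w < r i (s j).
Hypothesis cs : forall i, c (s i) = i.
Implicit Types (P Q d : {set W}) (w y : W).

Definition dominant P :=
  [forall y, exists i, forall p in P, r i y <= r i p].

Lemma dominantP P :
  reflect (forall y, exists i, forall p, p \in P -> r i y <= r i p)
          (dominant P).
Proof.
apply: (iffP forallP) => h y; have := h y.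
  by move=> /existsP[i /forall_inP hi]; exists i.
by move=> [i hi]; apply/existsP; exists i; apply/forall_inP.
Qed.

Lemma dominantS P Q : P \subset Q -> dominant Q -> dominant P.
Proof.
move=> /subsetP PQ /dominantP h; apply/dominantP => y.
by have [i hi] := h y; exists i => p /PQ; exact: hi.
Qed.

(** Apply dominance to an element of [P] itself: the index obtained makes that element a minimum of
    [P], hence the only one because the ranks are injective. So every element of [P] is hit by
    [m]. *)
Lemma argmin_dominant P p0 : p0 \in P -> dominant P ->
  exists m : I -> W,
    (forall i p, p \in P -> r i (m i) <= r i p) /\ m @: setT = P.
Proof.
move=> p0P /dominantP dP; exists (fun i => [arg min_(p < p0 in P) r i p]).
have mP i : [arg min_(p < p0 in P) r i p] \in P /\
    forall p, p \in P -> r i [arg min_(p < p0 in P) r i p] <= r i p.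
  by case: arg_minnP.
split=> [i|]; first exact: (mP i).2.
apply/setP => w; apply/imsetP/idP => [[i _ ->]|wP]; first exact: (mP i).1.
have [i hi] := dP w; exists i => //; apply: (@r_inj i); apply/eqP.
by rewrite eqn_leq hi ?(mP i).1//= (mP i).2.
Qed.

(* The map sending [i] to the [r i]-least element of a door is onto and
   identifies exactly one pair of indices [i], [j].  The element completing the
   door to a room must become the least one for [i] or for [j], and in each case
   it is the largest among the points lying above the other minima. *)
Lemma card_extensions d : #|d|.+1 = #|I| ->
  (exists2 x, x \in d & forall k, x != s k) -> dominant d ->
  #|[set w | (w \notin d) && dominant (w |: d)]| = 2.
Proof.
move=> cd [x0 x0d x0s] dd.
have [m [m_min m_im]] := argmin_dominant x0d dd.
have m_in i : m i \in d by rewrite -m_im imset_f.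
have [i [j [ij mij]]] : exists i j, i != j /\ m i = m j.
  have : ~~ injectiveb m.
    apply/negP => /injectiveP mi; have := card_imset setT mi.
    by rewrite m_im cardsT -cd => /n_Sn.
  by case/injectivePn => i [j ij mij]; exists i, j.
have m_onto k l : k != l -> m k = m l -> m @: [set~ k] = d.
  move=> kl mkl; apply/setP => w; rewrite -m_im.
  apply/imsetP/imsetP => [[a _ ->]|[a _ ->]]; first by exists a.
  have [->|ak] := eqVneq a k; last by exists a => //; rewrite !inE.
  by exists l => //; rewrite !inE eq_sym.
have m_inj k l : k != l -> m k = m l -> {in [set~ k] &, injective m}.
  move=> kl mkl; apply/imset_injP; rewrite (m_onto _ _ kl mkl).
  by rewrite cardsC1 -cd.
(* Once index [k] is released, the points of [M k] are those that no remaining minimum of [d]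
   dominates; a completion of the door that takes over [k] must be the highest of them. *)
pose M k := [set y | [forall (l | l != k), r l (m l) < r l y]].
have MP k y : reflect (forall l, l != k -> r l (m l) < r l y) (y \in M k).
  by rewrite inE; exact: forall_inP.
have sM k : s k \in M k.
  apply/MP => l lk; apply: leq_ltn_trans (m_min _ _ x0d) _.
  by apply: s_max => //; rewrite eq_sym.
pose x k := [arg max_(y > s k in M k) r k y].
have xP k : x k \in M k /\ forall y, y \in M k -> r k y <= r k (x k).
  by rewrite /x; case: arg_maxnP.
have x_ext k l : k != l -> m k = m l -> (x k \notin d) && dominant (x k |: d).
  move=> kl mkl; have [/MP xM x_max] := xP k; apply/andP; split.
    apply/negP; rewrite -(m_onto _ _ kl mkl) => /imsetP[a].
    by rewrite !inE => ak xa; have := xM _ ak; rewrite xa ltnn.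
  apply/dominantP => y; have [yM|] := boolP (y \in M k).
    have [a ya] := dominantP _ dd y.
    have ak : a = k.
      apply/eqP/negPn/negP => ak; have := MP _ _ yM _ ak.
      by rewrite ltnNge ya.
    exists k => p; rewrite !inE => /orP[/eqP -> |]; first exact: x_max.
    by rewrite -ak; exact: ya.
  rewrite inE negb_forall_in => /exists_inP[a ak]; rewrite -leqNgt => ya.
  exists a => p; rewrite !inE => /orP[/eqP -> |pd].
    by apply: leq_trans ya _; exact/ltnW/xM.
  exact: leq_trans ya (m_min _ _ pd).
(* A common value would lie above the minima of all orders: membership in [M i] handles every index
   but [i], membership in [M j] handles [i]. This contradicts dominance of [d]. *)
have xij : x i != x j.
  apply/negP => /eqP xij; have [a xa] := dominantP _ dd (x i).
  have := xa _ (m_in a); apply/negP; rewrite -ltnNge.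
  have [ai|ai] := eqVneq a i; last exact: (MP _ _ (xP i).1).
  by rewrite xij; apply: (MP _ _ (xP j).1); rewrite ai.
suff -> : [set w | (w \notin d) && dominant (w |: d)] = [set x i; x j].
  by rewrite cards2 xij.
apply/setP => w; rewrite in_set2 in_set; apply/idP/idP; last first.
  move=> /orP[/eqP -> |/eqP ->]; first exact: (x_ext i j).
  by apply: (x_ext j i); rewrite // eq_sym.
move=> /andP[wd dw].
have [m' [m'_min m'_im]] := argmin_dominant (setU11 w d) dw.
have m'_inj : injective m'.
  have : {in setT &, injective m'}.
    by apply/imset_injP; rewrite m'_im cardsU1 wd add1n cardsT cd.
  by move=> h a b; apply: h; rewrite inE.
have m'_in a : m' a \in w |: d by rewrite -m'_im imset_f.
(* In the completed room the minima are distinct, so [w] takes over a single index [k] and the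
   others keep their minimum. The old minimum of [k] must then still serve another index, which
   forces [k] to be [i] or [j]. *)
have [k wk] : exists k, w = m' k.
  by have := setU11 w d; rewrite -m'_im => /imsetP[k _ ->]; exists k.
have m'E a : a != k -> m' a = m a.
  move=> ak; apply: (@r_inj a); apply/eqP; rewrite eqn_leq.
  rewrite m'_min ?inE ?m_in ?orbT//= m_min//.
  have := m'_in a; rewrite !inE wk => /orP[/eqP/m'_inj ka|//].
  by rewrite ka eqxx in ak.
have [l lk mkl] : exists2 l, l != k & m l = m k.
  have : m k \in w |: d by rewrite !inE m_in orbT.
  rewrite -m'_im => /imsetP[l _ ml]; have lk : l != k.
    by apply: contraNneq wd => lk; rewrite wk -lk -ml.
  by exists l; rewrite // ml m'E.
have kij : (k == i) || (k == j).
  apply/norP => -[ki kj].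
  have [li|li] := eqVneq l i.
    have ji : j != i by rewrite eq_sym.
    have := m_inj _ _ ij mij k j; rewrite !inE ki ji => /(_ isT isT).
    by rewrite -mkl li mij => /(_ erefl) kj'; rewrite kj' eqxx in kj.
  have := m_inj _ _ ij mij k l; rewrite !inE ki li => /(_ isT isT).
  by rewrite mkl => /(_ erefl) kl; rewrite kl eqxx in lk.
suff -> : w = x k by move/orP: kij => [/eqP ->|/eqP ->]; rewrite eqxx ?orbT.
apply: (@r_inj k); apply/eqP; rewrite eqn_leq (xP k).2/=; last first.
  apply/MP => a ak; rewrite -m'E// ltn_neqAle m'_min ?setU11// andbT.
  by apply: contraNneq ak => /r_inj; rewrite wk => /m'_inj ->.
have [a xa] := dominantP _ dw (x k).
have [ak|ak] := eqVneq a k; first by move: xa; rewrite ak; apply; exact: setU11.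
have := xa (m a); rewrite !inE m_in orbT => /(_ isT).
by rewrite leqNgt (MP _ _ (xP k).1 _ ak).
Qed.

(** This is the door to the outside. The remaining slack cannot complete it, since a genuine point
    ranks above every slack in that slack's own order; among genuine points only the highest for
    [i0] leaves nothing undominated. *)
Lemma card_outer_extensions i0 x0 : (forall k, x0 != s k) ->
  let d := s @: [set~ i0] in
  #|[set w | (w \notin d) && dominant (w |: d)]| = 1.
Proof.
move=> x0s d.
have nsP w : reflect (forall k, w != s k) [forall k, w != s k].
  exact: forallP.
have sP w : ~~ [forall k, w != s k] -> exists k, w = s k.
  by rewrite negb_forall => /existsP[k]; rewrite negbK => /eqP ->; exists k.
pose x := [arg max_(w > x0 | [forall k, w != s k]) r i0 w].
have [/nsP xs x_max] : [forall k, x != s k] /\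
    forall y, [forall k, y != s k] -> r i0 y <= r i0 x.
  by rewrite /x; case: arg_maxnP; first exact/nsP.
rewrite -(cards1 x); congr #|pred_of_set _|.
apply/setP => w; rewrite in_set1 in_set; apply/idP/eqP => [/andP[wd dw]|->].
  have w0 : w <> s i0.
    move=> w0; have [i hi] := dominantP _ dw x0.
    have : s i \in w |: d.
      have [->|ii0] := eqVneq i i0; first by rewrite -w0 setU11.
      by rewrite !inE imset_f ?orbT// !inE.
    move=> /hi; rewrite leqNgt ltn_neqAle s_min andbT.
    by rewrite (inj_eq (@r_inj i)) eq_sym x0s.
  have ws k : w != s k.
    apply/eqP => wk; have [ki|ki] := eqVneq k i0; first by rewrite wk ki in w0.
    by rewrite wk imset_f ?inE in wd.
  apply: (@r_inj i0); apply/eqP; rewrite eqn_leq x_max; last exact/nsP.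
  have [i hi] := dominantP _ dw x.
  have [ii0|ii0] := eqVneq i i0.
    by move: hi; rewrite ii0; apply; exact: setU11.
  have : s i \in w |: d by rewrite !inE imset_f ?orbT// !inE.
  move=> /hi; rewrite leqNgt ltn_neqAle s_min andbT.
  by rewrite (inj_eq (@r_inj i)) eq_sym xs.
apply/andP; split.
  by apply/imsetP => -[k _ xk]; have := xs k; rewrite xk eqxx.
apply/dominantP => y.
have [/[dup] ys /nsP ys'|/sP[k ->]] := boolP [forall k, y != s k].
  exists i0 => p; rewrite !inE => /orP[/eqP -> |]; first exact: x_max.
  by move=> /imsetP[k]; rewrite !inE => ki ->; exact/ltnW/s_max.
by exists k => p _; exact: s_min.
Qed.

Let door i0 d := (#|d|.+1 == #|I|) && (c @: d == [set~ i0]).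

(** A door that is not dominant has no completion, and one with a genuine point has none or two. A
    door made of slacks only is determined by its colours, so it is the outer one. *)
Lemma odd_door_extensions i0 x0 d : (forall k, x0 != s k) -> door i0 d ->
  odd #|[set w | (w \notin d) && dominant (w |: d)]| = (d == s @: [set~ i0]).
Proof.
move=> x0s /andP[/eqP cd /eqP cdi].
have [->|dO] := eqVneq; first by rewrite (card_outer_extensions _ x0s).
have [dd|ndd] := boolP (dominant d); last first.
  rewrite (_ : [set _ | _] = set0) ?cards0//; apply/setP => w.
  rewrite !inE; apply: contraNF ndd => /andP[_]; apply: dominantS.
  exact: subsetUr.
rewrite card_extensions//.
have [/exists_inP[x xd /forallP xs]|] :=
  boolP [exists x in d, [forall k, x != s k]].
  by exists x.
rewrite negb_exists_in => /forall_inP ds; case/eqP: dO.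
have ds' p : p \in d -> p = s (c p).
  move=> /ds; rewrite negb_forall => /existsP[k]; rewrite negbK => /eqP ->.
  by rewrite cs.
apply/setP => w; apply/idP/imsetP => [wd|[k + ->]].
  by exists (c w); rewrite -?ds'// -cdi imset_f.
by rewrite -cdi => /imsetP[p pd ->]; rewrite -ds'.
Qed.

(** If removing [w] leaves a door, the colour of [w] is not [i0], for otherwise [P] would show all
    colours. It is thus repeated by exactly one other element [w'], and [w], [w'] are the only two
    whose removal leaves a door. *)
Lemma even_room_doors i0 P : c @: P != setT ->
  ~~ odd #|[set w in P | door i0 (P :\ w)]|.
Proof.
move=> cP; set E := [set w in P | _].
have [->|[w]] := set_0Vmem E; first by rewrite cards0.
rewrite !inE => /andP[wP /andP[/eqP cw /eqP cwi]].
have c_inj : {in P :\ w &, injective c}.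
  apply/imset_injP; rewrite cwi cardsC1.
  by rewrite -cw.
have PE : P = w |: P :\ w by rewrite setD1K.
have cwi0 : c w != i0.
  apply: contra cP => /eqP cwe; rewrite PE imsetU1 cwi cwe.
  by apply/eqP/setP => k; rewrite !inE; case: eqP.
have : c w \in [set~ i0] by rewrite !inE.
rewrite -cwi => /imsetP[w' w'P cww'].
suff -> : E = [set w; w'].
  by rewrite cards2; move: w'P; rewrite !inE eq_sym => /andP[-> _].
move: (w'P); rewrite !inE => /andP[w'w w'P'].
apply/setP => z; rewrite !inE; apply/idP/idP.
  move=> /andP[zP /andP[/eqP cz /eqP czi]]; apply/norP => -[zw zw'].
  have : c z \in c @: (P :\ w) by rewrite imset_f// !inE zw.
  rewrite cwi -czi => /imsetP[p]; rewrite !inE => /andP[pz pP] czp.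
  case/eqP: pz; have [pw|pw] := eqVneq p w; last first.
    by apply: c_inj; rewrite // !inE ?pw ?zw.
  case/eqP: zw'; apply: c_inj => //; rewrite ?inE ?zw//.
  by rewrite czp pw.
move=> /orP[/eqP ->|/eqP ->]; first by rewrite wP /door cw cwi !eqxx.
rewrite w'P' /door -cwi andTb; apply/andP; split.
  by have := cardsD1 w P; rewrite (cardsD1 w' P) wP w'P' -cw !add1n => ->.
apply/eqP/setP => k; apply/imsetP/imsetP => -[p].
  rewrite !inE => /andP[pw' pP] ->; have [->|pw] := eqVneq p w.
    by exists w'.
  by exists p; rewrite // !inE pw.
rewrite !inE => /andP[pw pP] ->; have [->|pw'] := eqVneq p w'.
  by exists w; rewrite ?cww'// !inE eq_sym w'w.
by exists p; rewrite // !inE pw'.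
Qed.

Lemma scarf x0 : (forall k, x0 != s k) ->
  exists P, dominant P /\ forall i, exists2 p, p \in P & c p = i.
Proof.
move=> x0s; have [/existsP[P /andP[dP /eqP cP]]|] :=
  boolP [exists P, dominant P && (c @: P == setT)].
  exists P; split=> // i; have : i \in setT by [].
  by rewrite -cP => /imsetP[p pP ->]; exists p.
rewrite negb_exists => /forallP noP; exfalso; pose i0 := c x0.
(* Pairs of a door and a completing point, to be counted twice: by doors only the outer one
   contributes an odd number, while by rooms every contribution is even as long as no room shows all
   colours. *)
pose N := \sum_(w : W) \sum_(d : {set W} |
  door i0 d && (w \notin d) && dominant (w |: d)) 1.
have doorO : door i0 (s @: [set~ i0]).
  have s_inj : injective s by move=> i j /(congr1 c); rewrite !cs.
  rewrite /door card_imset// cardsC1 prednK ?eqxx/=; last first.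
    by apply/card_gt0P; exists i0.
  by rewrite -imset_comp (eq_imset _ (g := id)) ?imset_id// => k /=; exact: cs.
have oddN : odd N.
  rewrite /N (exchange_big_dep (door i0)) /=; last first.
    by move=> w d _ /andP[/andP[]].
  rewrite (big_morph odd oddD (erefl (odd 0))) (bigD1 (s @: [set~ i0]))//=.
  have dsum d : door i0 d ->
      odd (\sum_(w | door i0 d && (w \notin d) && dominant (w |: d)) 1) =
      (d == s @: [set~ i0]).
    by move=> dd; rewrite sum1_card -(odd_door_extensions x0s dd) cardsE dd.
  rewrite dsum ?eqxx//.
  by rewrite big1// => d /andP[dd dO]; rewrite dsum// (negbTE dO).
have : ~~ odd N.
  have -> : N = \sum_(P | dominant P) #|[set w in P | door i0 (P :\ w)]|.
    under [RHS]eq_bigr do rewrite -sum1_card.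
    rewrite (exchange_big_dep predT)//=; apply: eq_bigr => w _.
    rewrite (reindex_onto (fun P => P :\ w) (fun d => w |: d)) /=; last first.
      by move=> d /andP[/andP[_ wd] _]; rewrite setU1K.
    apply: eq_bigl => P; rewrite !inE eqxx/= andbT.
    have [wP|wP] := boolP (w \in P).
      by rewrite setD1K// eqxx !andbT andbC.
    rewrite andbF; apply/negP => /andP[_ /eqP PE].
    by move: wP; rewrite -PE setU11.
  rewrite (big_morph odd oddD (erefl (odd 0))) big1// => P dP.
  by apply/negbTE/even_room_doors; have := noP P; rewrite dP.
by rewrite oddN.
Qed.
End Scarf.

(** * Brouwer's theorem on the simplex *)

Definition grid n m := {g : {ffun 'I_n -> 'I_m.+1} | \sum_i g i == m}.

Definition gval n m (g : grid n m) i : nat := sval g i.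

Lemma gval_le n m (g : grid n m) i : gval g i <= m.
Proof. rewrite -ltnS; exact: ltn_ord. Qed.

Lemma grid_sum n m (g : grid n m) : \sum_i gval g i = m.
Proof. exact/eqP/(proj2_sig g). Qed.

Lemma grid_ex n m (a : 'I_n -> nat) : \sum_i a i = m ->
  exists g : grid n m, forall i, gval g i = a i.
Proof.
move=> am; have ale i : a i <= m by rewrite -am (bigD1 i)//= leq_addr.
pose h : {ffun 'I_n -> 'I_m.+1} := [ffun i => inord (a i)].
have hE i : h i = a i :> nat by rewrite ffunE inordK// ltnS.
have hP : \sum_i h i == m by rewrite (eq_bigr _ (fun i _ => hE i)) am.
by exists (exist (fun g : {ffun 'I_n -> 'I_m.+1} => \sum_i g i == m) h hP).
Qed.

Lemma grid_ex_ge n m (C : pred 'I_n) (a : 'I_n -> nat) i1 : C i1 ->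
  \sum_(i | C i) a i <= m ->
  exists g : grid n m, forall i, C i -> a i <= gval g i.
Proof.
move=> Ci1 am; set S := (X in X <= m) in am.
have [|g gE] := @grid_ex n m
  (fun i => (if C i then a i else 0) + (i == i1) * (m - S)).
  rewrite big_split/= -big_mkcond/= -/S -big_distrl/=.
  by rewrite (bigD1 i1)//= eqxx big1 ?addn0 ?mul1n ?subnKC// => i /negbTE ->.
by exists g => i Ci; rewrite gE Ci leq_addr.
Qed.

(** The excesses [b k - a k] and [d] are nonnegative and add up to at most [m] minus the sum of the
    [a k], which is below [#|C|]; hence each of them is below [#|C|]. *)
Lemma sum_lt_close (I : finType) (C : pred I) (a b : I -> nat) m d :
  (forall k, C k -> a k <= b k) -> m < \sum_(k | C k) (a k).+1 ->
  \sum_(k | C k) b k + d <= m ->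
  (forall i, C i -> b i < a i + #|C|) /\ d < #|C|.
Proof.
move=> ab; under eq_bigr do rewrite -addn1.
rewrite big_split/= sum1_card => am bm; split=> [i Ci|].
  rewrite ltnNge; apply/negP => h; move: am; apply/negP; rewrite -leqNgt.
  apply: leq_trans _ (leq_trans (leq_addr d _) bm).
  rewrite (bigD1 i)//= [leqRHS](bigD1 i)//= addnAC leq_add// leq_sum// => k.
  by move=> /andP[/ab].
have : \sum_(k | C k) a k <= \sum_(k | C k) b k by apply: leq_sum.
move=> le_ab; rewrite -(ltn_add2l (\sum_(k | C k) b k)) (leq_ltn_trans bm)//.
by rewrite (leq_trans am)// leq_add2r.
Qed.

(** A substitute for Sperner's lemma without a triangulation: the grid points of a dominant set
    showing all colours form a cluster. Their coordinatewise minima nearly exhaust the total [m], so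
    all coordinates agree up to [n]; where the colour [i] comes only from a slack, the [i]-th
    coordinate is itself below [n]. *)
Lemma sperner_grid n m (col : grid n m -> 'I_n) : 0 < n ->
  exists w : grid n m, forall i, gval w i < n \/
    exists2 g : grid n m, col g = i &
      forall j, (gval g j < gval w j + n) && (gval w j < gval g j + n).
Proof.
move=> n0.
have [|g0 _] := @grid_ex_ge n m predT (fun=> 0) (Ordinal n0) isT.
  by rewrite big1.
pose W := (grid n m + 'I_n)%type.
pose N := #|{: grid n m}|.
(* The [i]-th order is by [i]-th coordinate, with ties broken by [enum_rank]. *)
pose r (i : 'I_n) (w : W) := match w with
  | inl g => (gval g i * N + enum_rank g).+1
  | inr j => if j == i then 0 else (m.+1 * N + j).+1 end.
have rlt i (g : grid n m) : gval g i * N + enum_rank g < m.+1 * N.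
  have : gval g i * N <= m * N by rewrite leq_mul ?gval_le.
  have := ltn_ord (enum_rank g); rewrite -/N mulSn; lia.
have rle i (g h : grid n m) :
    r i (inl g) <= r i (inl h) -> gval g i <= gval h i.
  rewrite /r !ltnS => gh; rewrite leqNgt; apply/negP => hg; move: gh.
  apply/negP; rewrite -ltnNge; apply: leq_trans (leq_addr _ _).
  by apply: leq_trans (leq_mul hg (leqnn N)); rewrite mulSn addnC ltn_add2r.
have r_inj i : injective (r i).
  move=> [g|j] [h|k] /=.
  - move=> gh; congr inl; apply/enum_rank_inj/val_inj => /=.
    have := rle i g h; have := rle i h g; rewrite /r gh leqnn.
    by move=> /(_ isT) + /(_ isT); nia.
  - case: ifP => // _ /eqP; rewrite eqSS => /eqP gE.
    by have := rlt i g; rewrite gE ltnNge leq_addr.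
  - case: ifP => // _ /eqP; rewrite eqSS => /eqP gE.
    by have := rlt i h; rewrite -gE ltnNge leq_addr.
  - case: eqVneq => [->|_]; case: eqVneq => [->|_]// jk.
    congr inr; apply/val_inj/eqP; rewrite -(eqn_add2l (m.+1 * N)) -eqSS.
    exact/eqP.
pose c (w : W) := match w with inl g => col g | inr i => i end.
have [||||P [/dominantP dP cP]] :=
    @scarf _ _ r (inr : 'I_n -> W) c r_inj _ _ _ (inl g0).
- by move=> i w; rewrite /= eqxx.
- move=> i j [g|k] ji; last by move=> /(_ k); rewrite eqxx.
  by move=> _; rewrite /= (negbTE ji) !ltnS (leq_trans (rlt i g))// leq_addr.
- by [].
- by move=> k.
(* A slack has rank 0 in its own order, so once it belongs to [P] its index cannot witness dominance
   over a grid point. Only the indices in [C] can. *)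
pose C : pred 'I_n := fun i => inr i \notin P.
have dC (g : grid n m) :
    exists2 i, C i & forall h, inl h \in P -> gval g i <= gval h i.
  have [i hi] := dP (inl g); exists i; last by move=> h /hi; exact: rle.
  by apply/negP => /hi; rewrite /= eqxx.
have cC i : C i -> exists2 g, inl g \in P & col g = i.
  move=> Ci; have [[g|j] gP /= gi] := cP i; first by exists g.
  by move: Ci; rewrite /C -gi gP.
have [i1 Ci1 _] := dC g0; have [w wP _] := cC i1 Ci1.
pose x i := [arg min_(g < w | inl g \in P) gval g i].
have xP i :
    inl (x i) \in P /\ forall g, inl g \in P -> gval (x i) i <= gval g i.
  by rewrite /x; case: arg_minnP.
(* Otherwise the minima, each raised by one, would fit into the total [m], and [grid_ex_ge] would
   yield a grid point strictly above all of them, against dominance. *)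
have Csum : m < \sum_(i | C i) (gval (x i) i).+1.
  rewrite ltnNge; apply/negP => /(grid_ex_ge Ci1)[g gE].
  have [i Ci /(_ _ (xP i).1)] := dC g.
  by rewrite leqNgt gE.
have close (g : grid n m) : inl g \in P ->
    (forall i, C i -> gval g i < gval (x i) i + n) /\
    (forall i, ~~ C i -> gval g i < n).
  move=> gP; have Cn : #|C| <= n by rewrite (leq_trans (max_card _))// card_ord.
  have xg k : C k -> gval (x k) k <= gval g k by move=> _; exact: (xP k).2.
  have gm := grid_sum g; rewrite (bigID C)/= in gm.
  split=> i Ci.
    have [+ _] := sum_lt_close xg Csum (eq_leq gm).
    move=> /(_ i Ci) /leq_trans; apply.
    by rewrite leq_add2l.
  rewrite (leq_trans _ Cn)// (sum_lt_close xg Csum _).2//.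
  by rewrite -[leqRHS]gm leq_add2l (bigD1 i)//= leq_addr.
exists w => i; have [Ci|Ci] := boolP (C i); last by left; exact: (close w wP).2.
right; have [g gP gi] := cC i Ci; exists g => // j.
have [Cj|Cj] := boolP (C j).
  have := (close w wP).1 _ Cj; have := (close g gP).1 _ Cj.
  have := (xP j).2 _ gP; have := (xP j).2 _ wP; lia.
by have := (close w wP).2 _ Cj; have := (close g gP).2 _ Cj; lia.
Qed.

From mathcomp Require Import all_classical all_reals all_analysis.

Import Order.TTheory GRing.Theory Num.Theory.
Import numFieldNormedType.Exports.

Local Open Scope classical_set_scope.
Local Open Scope ring_scope.

(** * Continuity of composite maps and of the vector operations *)

Section continuous_composition.
Context {S U V : topologicalType}.

Lemma cts_fst (f : S -> U * V) : continuous f -> continuous (fun x => (f x).1).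
Proof. by move=> cf x; apply: continuous_comp; [exact: cf|exact: cvg_fst]. Qed.

Lemma cts_snd (f : S -> U * V) : continuous f -> continuous (fun x => (f x).2).
Proof. by move=> cf x; apply: continuous_comp; [exact: cf|exact: cvg_snd]. Qed.

Lemma cts_pair (f : S -> U) (g : S -> V) : continuous f -> continuous g ->
  continuous (fun x => (f x, g x)).
Proof. by move=> cf cg x; apply: cvg_pair; [exact: cf|exact: cg]. Qed.

Lemma cts_comp (g : U -> V) (f : S -> U) : continuous g -> continuous f ->
  continuous (fun x => g (f x)).
Proof. by move=> cg cf x; apply: continuous_comp; [exact: cf|exact: cg]. Qed.

Lemma cts_id : continuous (fun x : S => x).
Proof. by move=> x. Qed.

Lemma closed_preimage (f : S -> U) (A : set U) : continuous f -> closed A ->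
  closed [set x | A (f x)].
Proof. by move=> cf cA; apply: closed_comp => // x _; exact: cf. Qed.

End continuous_composition.

Section continuous_operations.
Context {R : realType} {V : normedModType R} {S : topologicalType}.

Lemma cts_cst (a : V) : continuous (fun _ : S => a).
Proof. by move=> x; exact: cvg_cst. Qed.

Lemma ctsD (f g : S -> V) : continuous f -> continuous g ->
  continuous (fun x => f x + g x).
Proof. by move=> cf cg x; apply: cvgD; [exact: cf|exact: cg]. Qed.

Lemma ctsB (f g : S -> V) : continuous f -> continuous g ->
  continuous (fun x => f x - g x).
Proof. by move=> cf cg x; apply: cvgB; [exact: cf|exact: cg]. Qed.

Lemma ctsZ (s : S -> R) (f : S -> V) : continuous s -> continuous f ->
  continuous (fun x => s x *: f x).
Proof. by move=> cs cf x; apply: cvgZ; [exact: cs|exact: cf]. Qed.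

Lemma ctsM (s t : S -> R) : continuous s -> continuous t ->
  continuous (fun x => s x * t x).
Proof. by move=> cs ct x; apply: cvgM; [exact: cs|exact: ct]. Qed.

Lemma ctsV (s : S -> R) : continuous s -> (forall x, s x != 0) ->
  continuous (fun x => (s x)^-1).
Proof. by move=> cs s0 x; apply: cvgV => //; exact: cs. Qed.

Lemma cts_norm (f : S -> V) : continuous f -> continuous (fun x => `|f x|).
Proof. by move=> cf x; apply: cvg_norm; exact: cf. Qed.

Lemma cts_max (s t : S -> R) : continuous s -> continuous t ->
  continuous (fun x => Num.max (s x) (t x)).
Proof. by move=> cs ct x; apply: continuous_max; [exact: cs|exact: ct]. Qed.

End continuous_operations.

Lemma continuous_sum (R : numFieldType) (V : normedModType R)
    (S : topologicalType) (I : finType) (F : I -> S -> V) :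
  (forall i, continuous (F i)) -> continuous (fun x => \sum_i F i x).
Proof.
move=> cF x; apply: (@cvg_big _ _ +%R) => [y|i _]; last exact: cF.
  by apply: (cvgD cvg_fst cvg_snd).
Qed.

(** * From the grid to Brouwer's theorem *)

Definition simplex (R : realType) n : set 'rV[R]_n :=
  [set x | (forall i, 0 <= x ord0 i) /\ \sum_i x ord0 i = 1].

Lemma simplex_compact (R : realType) n : compact (@simplex R n).
Proof.
have cube : compact [set v : 'rV[R]_n | forall i, `[0, 1]%classic (v ord0 i)].
  apply: (@rV_compact R n (fun=> `[0, 1]%classic)) => i.
  exact: segment_compact.
apply: subclosed_compact cube _; last first.
  move=> x [x0 x1] i; rewrite /= in_itv/= x0/= -x1 (bigD1 i)//= lerDl.
  by apply: sumr_ge0.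
have -> : @simplex R n = \bigcap_(i in setT)
    ((fun x : 'rV[R]_n => x ord0 i) @^-1` [set y | 0 <= y]) `&`
    ((fun x : 'rV[R]_n => \sum_i x ord0 i) @^-1` [set 1]).
  by apply/seteqP; split=> x [x0 x1]; split=> // i; [move=> _|]; exact: x0.
apply: closedI.
  apply: closed_bigI => i _; apply: closed_comp; last exact: closed_ge.
  by move=> x _; exact: coord_continuous.
apply: closed_comp; last exact: closed_eq.
move=> x _; apply: (@continuous_sum _ R^o) => i.
exact: coord_continuous.
Qed.

Lemma simplex_le_eq (R : realType) n (x y : 'rV[R]_n) :
  simplex x -> simplex y -> (forall i, x ord0 i <= y ord0 i) -> x = y.
Proof.
move=> [_ x1] [_ y1] xy; apply/rowP => i; apply/eqP; rewrite eq_le xy/=.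
rewrite leNgt; apply/negP => yi; suff : \sum_i x ord0 i < \sum_i y ord0 i.
  by rewrite x1 y1 ltxx.
by rewrite (bigD1 i)//= [ltRHS](bigD1 i)//= ltr_leD// ler_sum.
Qed.

(** Coordinates sum to 1, so a point that is not fixed has a coordinate which [f] decreases and one
    which it does not. Compactness makes the decrease uniform at a scale [e]; colouring grid points
    by a coordinate that is not decreased then contradicts [sperner_grid]. *)
Lemma brouwer_simplex (R : realType) n (f : 'rV[R]_n -> 'rV[R]_n) :
  (0 < n)%N -> continuous f -> (forall x, simplex x -> simplex (f x)) ->
  exists2 x, simplex x & f x = x.
Proof.
move=> n0 cf fS; apply: contrapT => nofix.
have dec (x : 'rV[R]_n) : simplex x -> exists i, f x ord0 i < x ord0 i.
  move=> Sx; apply: contrapT => h; apply: nofix; exists x => //.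
  apply/esym/simplex_le_eq => //; first exact: fS.
  by move=> i; rewrite leNgt; apply/negP => fx; apply: h; exists i.
(* The negation, at scale [e], of what [sperner_grid] asserts of [w]. *)
pose P (e : R) (w : 'rV[R]_n) := exists i, e < w ord0 i /\
  forall x : 'rV[R]_n, (forall j, `|w ord0 j - x ord0 j| < e) ->
    f x ord0 i < x ord0 i.
have : \forall e \near (0 : R)^'+, @simplex R n `<=` P e.
  apply: (iffLR (compact_near_coveringP _)) (@simplex_compact R n) _ _ _ _ _.
  move=> w Sw; have [i fwi] := dec w Sw.
  have wi : 0 < w ord0 i by apply: le_lt_trans fwi; exact: (fS _ Sw).1.
  have : \forall x \near w, f x ord0 i < x ord0 i.
    have cg : continuous (fun x : 'rV[R]_n => x ord0 i - f x ord0 i).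
      apply: (@ctsB _ R^o); first by move=> x; exact: coord_continuous.
      apply: (cts_comp (g := fun x : 'rV[R]_n => x ord0 i)) => // x.
      exact: coord_continuous.
    have : open [set x : 'rV[R]_n | 0 < x ord0 i - f x ord0 i].
      apply: (@open_comp _ _ _ [set y : R | 0 < y]) => [x _|]; first exact: cg.
      exact: open_gt.
    rewrite openE => /(_ w); rewrite /= subr_gt0 => /(_ fwi).
    by rewrite /interior/=; under eq_fun do rewrite subr_gt0.
  move=> /nbhs_ballP[r /= r0 rO].
  have wi2 : 0 < w ord0 i / 2 by rewrite divr_gt0.
  have r2 : 0 < r / 2 by rewrite divr_gt0.
  near=> x e; exists i.
  have xw : ball w (Num.min (r / 2) (w ord0 i / 2)) x.
    by near: x; apply: nbhsx_ballx; rewrite lt_min r2 wi2.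
  have xwj j : `|w ord0 j - x ord0 j| < Num.min (r / 2) (w ord0 i / 2).
    by case: xw => _; exact.
  have er : e < r / 2 by near: e; exact: nbhs_right_lt.
  have ew : e < w ord0 i / 2 by near: e; exact: nbhs_right_lt.
  split.
    have := xwj i; rewrite lt_min => /andP[_]; rewrite ltr_norml => /andP[_].
    by move=> /=; lra.
  move=> y /= xy; apply: rO; split=> // k j; rewrite (ord1 k).
  rewrite /ball/= -(subrKA (x ord0 j)) (le_lt_trans (ler_normD _ _))//.
  have := xwj j; rewrite lt_min => /andP[xw1 _]; have := xy j; lra.
move=> nearP.
have [e [e0 SP]] : exists e : R, 0 < e /\ @simplex R n `<=` P e.
  near (0 : R)^'+ => e; exists e; split=> //; near: e; exact: nearP.
(* The tolerance of [sperner_grid] is [n] grid steps, so the mesh [1 / m.+1] must satisfy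
   [n / m.+1 < e]. *)
have [m mP] : exists m, n%:R / m.+1%:R < e.
  exists (Num.truncn (n%:R / e)); rewrite ltr_pdivrMr// mulrC -ltr_pdivrMr//.
  exact: truncnS_gt.
pose pt (g : grid n m.+1) : 'rV[R]_n := \row_i ((gval g i)%:R / m.+1%:R).
have ptS g : simplex (pt g).
  split=> [i|]; first by rewrite mxE divr_ge0.
  under eq_bigr do rewrite mxE.
  by rewrite -mulr_suml -natr_sum grid_sum divff.
have /choice[col colP] (g : grid n m.+1) :
    exists i, pt g ord0 i <= f (pt g) ord0 i.
  apply: contrapT => h; apply: nofix; exists (pt g) => //.
  apply: simplex_le_eq => //; first exact: fS.
  move=> i; rewrite leNgt; apply/negP => fx; apply: h; exists i.
  exact: ltW.
have [w wP] := sperner_grid col n0.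
have [i [ewi Pw]] := SP _ (ptS w).
(* The coordinate [i] given by [P] exceeds [e], which rules out the small alternative. In the other
   one [g] is coloured [i], yet lies close enough to [w] for [f] to decrease its coordinate [i]. *)
have [wn|[g gi gw]] := wP i.
  move: ewi; apply/negP; rewrite -leNgt mxE.
  by rewrite ltW// (le_lt_trans _ mP)// ler_pM2r ?invr_gt0// ler_nat ltnW.
have := colP g; rewrite gi leNgt Pw// => j.
rewrite !mxE -mulrBl normrM (@ger0_norm _ m.+1%:R^-1)//.
rewrite (lt_trans _ mP)// ltr_pM2r ?invr_gt0// ltr_norml.
have /andP[] := gw j.
by rewrite -!(ltr_nat R) !natrD; lra.
Unshelve. all: by end_near. Qed.

Lemma continuous_rV (R : realType) (S : topologicalType) n
    (f : S -> 'rV[R]_n) :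
  (forall i, continuous (fun x => f x ord0 i)) -> continuous f.
Proof.
move=> cf x; apply/cvgrPdist_lt => e e0.
have e2 : 0 < e / 2 by rewrite divr_gt0.
have : \forall t \near x, forall i, `|f x ord0 i - f t ord0 i| < e / 2.
  by apply: filter_forall => i; have /cvgrPdist_lt := cf i x; apply.
apply: filterS => t ft; rewrite (@le_lt_trans _ _ (e / 2))//; last by lra.
rewrite [leLHS]/Num.norm/= mx_normrE.
apply: bigmax_le => [|[i j] _ /=]; first exact: ltW.
by rewrite !mxE (ord1 i) ltW.
Qed.

(** * Maps of finite rank *)

(** Nonnegative coefficients with a common bound become barycentric coordinates after division by a
    constant, which is the form Brouwer's theorem on the simplex can use. *)
Definition finite_rank (R : realType) (S : topologicalType)
    (W : normedModType R) (f : S -> W) :=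
  exists k (c : 'I_k -> S -> R) (p : 'I_k -> W) (b : R),
    [/\ forall i, continuous (c i : S -> R^o), forall i z, 0 <= c i z <= b &
      forall z, f z = \sum_i c i z *: p i].

(** The fixed point is sought among coefficient vectors: a point of the simplex yields a vector
    [z x], whose coefficients divided by [B] give a point of the simplex again, the coordinate
    [ord0] taking the missing mass. The summand 1 in [B] keeps it positive. *)
Lemma finite_rank_fixpoint (R : realType) (Z : normedModType R) (f : Z -> Z) :
  finite_rank f -> exists z, f z = z.
Proof.
move=> [k [c [p [b [cc cb fE]]]]]; pose B : R := `|b| *+ k + 1.
have B0 : 0 < B by rewrite ltr_wpDl// mulrn_wge0.
have cB z : \sum_i c i z <= B.
  rewrite (@le_trans _ _ (`|b| *+ k))//; last by rewrite lerDl.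
  rewrite -[X in _ *+ X](card_ord k) -sumr_const; apply: ler_sum => i _.
  by have /andP[_ cib] := cb i z; rewrite (le_trans cib)// ler_norm.
pose z (x : 'rV[R]_k.+1) := \sum_i (B * x ord0 (lift ord0 i)) *: p i.
have cz : continuous z.
  apply: continuous_sum => i; apply: ctsZ; last exact: cts_cst.
  by apply: ctsM; [exact: cts_cst|move=> x; exact: coord_continuous].
pose F (x : 'rV[R]_k.+1) : 'rV[R]_k.+1 := \row_i
  if unlift ord0 i is Some j then c j (z x) / B
  else 1 - (\sum_j c j (z x)) / B.
have FE x j : F x ord0 (lift ord0 j) = c j (z x) / B by rewrite mxE liftK.
have FE0 x : F x ord0 ord0 = 1 - (\sum_j c j (z x)) / B.
  by rewrite mxE unlift_none.
have cF : continuous F.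
  apply: continuous_rV => i; under eq_fun do rewrite mxE.
  have cczB j : continuous (fun x => c j (z x) : R^o).
    by move=> x; apply: continuous_comp; [exact: cz|exact: cc].
  case: unliftP => [j _|_].
    by apply: ctsM; [exact: cczB|exact: cts_cst].
  apply: (@ctsB _ R^o); first exact: cts_cst.
  by apply: ctsM; [exact: (continuous_sum cczB)|exact: cts_cst].
have [|x _ Fx] := brouwer_simplex (ltn0Sn k) cF.
  move=> x _; split=> [i|].
    rewrite mxE; case: unliftP => [j _|_].
      by rewrite divr_ge0//; [have /andP[] := cb j (z x)|exact: ltW].
    by rewrite subr_ge0 ler_pdivrMr// mul1r.
  rewrite big_ord_recl FE0 (eq_bigr _ (fun i _ => FE x i)).
  by rewrite -mulr_suml subrK.
exists (z x); rewrite fE {2}/z; apply: eq_bigr => i _; congr (_ *: _).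
by rewrite -[in RHS]Fx FE mulrCA divff ?mulr1// gt_eqF.
Qed.

(** * Urysohn functions, convex combinations and Schauder's approximation *)

Lemma urysohn_metric (R : realType) (Z : pseudoMetricType R) (A B : set Z) :
  closed A -> closed B -> A `&` B = set0 ->
  exists f : Z -> R, [/\ continuous (f : Z -> R^o), forall z, 0 <= f z <= 1,
    forall z, A z -> f z = 0 & forall z, B z -> f z = 1].
Proof.
move=> clA clB AB.
have [f [cf f0 f1 f01]] :=
  urysohn_ext_itv (@pseudometric_normal R Z) clA clB AB (@ltr01 R).
exists f; split=> // [z|z Az|z Bz].
- by have := f01 (f z) (imageT f z); rewrite /= ?in_itv/=.
- by apply: f0; exists z.
- by apply: f1; exists z.
Qed.

Definition convex (R : realType) (W : lmodType R) (C : set W) :=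
  forall x y (t : R), C x -> C y -> 0 <= t <= 1 -> C (t *: x + (1 - t) *: y).

Lemma convex_setE (R : realType) (W : lmodType R) (C : set W) :
  convex_set C -> convex C.
Proof.
move=> cC x y t Cx Cy /andP[t0 t1].
have t01 : Itv.spec (@Itv.num_sem R) (Itv.Real `[0%Z, 1%Z]) t.
  by rewrite /= /Itv.num_sem/= in_itv/= t0 t1 num_real.
by have := cC x y (Itv.Def t01); rewrite !inE => /(_ Cx Cy).
Qed.

Lemma convex_sum (R : realType) (W : lmodType R) (C : set W) k
    (c : 'I_k -> R) (p : 'I_k -> W) :
  convex C -> (forall i, 0 <= c i) -> \sum_i c i = 1 -> (forall i, C (p i)) ->
  C (\sum_i c i *: p i).
Proof.
elim: k c p => [|k IH] c p cC c0 c1 Cp.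
  by move: c1; rewrite big_ord0 => /esym/eqP; rewrite oner_eq0.
rewrite big_ord_recl.
have S0 : 0 <= \sum_(i < k) c (lift ord0 i) by apply: sumr_ge0.
have cE : c ord0 = 1 - \sum_(i < k) c (lift ord0 i).
  by apply/eqP; rewrite eq_sym subr_eq -c1 big_ord_recl.
have [Sz|Snz] := eqVneq (\sum_(i < k) c (lift ord0 i)) 0.
  rewrite cE Sz subr0 scale1r big1 ?addr0// => i _.
  suff -> : c (lift ord0 i) = 0 by rewrite scale0r.
  by apply: (psumr_eq0P _ Sz).
set S := \sum_(i < k) c (lift ord0 i) in S0 cE Snz *.
have -> : \sum_(i < k) c (lift ord0 i) *: p (lift ord0 i) =
    (1 - c ord0) *: \sum_(i < k) (c (lift ord0 i) / S) *: p (lift ord0 i).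
  rewrite cE subKr scaler_sumr; apply: eq_bigr => i _.
  by rewrite scalerA mulrCA divff// mulr1.
apply: (cC) => //; last by rewrite c0/= cE lerBlDr lerDl.
apply: IH => //; [by move=> i; apply: divr_ge0|].
by rewrite -mulr_suml divff.
Qed.

Lemma compact_net (R : realType) (W : normedModType R) (B : set W) (e : R) :
  compact (closure B) -> 0 < e ->
  exists k (q : 'I_k -> W), (forall i, B (q i)) /\
    forall w, B w -> exists i, `|w - q i| < e.
Proof.
rewrite compact_cover => cB e0.
have [||D' D'B cov] := cB W B (fun q => ball q e).
- by move=> i _; exact: ball_open.
- move=> w /(_ _ (nbhsx_ballx w e e0))[q [Bq wq]].
  by exists q => //; exact: ball_sym.
pose l := finmap.enum_fset D'.
exists (size l), (fun i => tnth (in_tuple l) i); split.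
  by move=> i; have := mem_tnth i (in_tuple l) => /D'B; rewrite inE.
move=> w /subset_closure /cov[q /= qD' qw].
have ql : q \in l by [].
have iq : (index q l < size l)%N by rewrite index_mem.
exists (Ordinal iq); rewrite (tnth_nth 0)/= nth_index// distrC.
by move: qw; rewrite -ball_normE.
Qed.

(** Schauder's projection: average the points of a finite net with weights [e - |T z - q i|], cut
    off at 0. The weights are real functions, so they extend beyond [A] while the approximant
    remains a convex combination of points of [C]. *)
Lemma compact_approx (R : realType) (Z W : normedModType R) (A : set Z)
    (C : set W) (T : Z -> W) (e : R) :
  closed A -> {within A, continuous T} -> compact (closure (T @` A)) ->
  T @` A `<=` C -> C !=set0 -> 0 < e ->
  exists k (c : 'I_k -> Z -> R) (p : 'I_k -> W),
    [/\ forall i, continuous (c i : Z -> R^o), forall i z, 0 <= c i z,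
      forall z, \sum_i c i z = 1, forall i, C (p i) &
      forall z, A z -> `|T z - \sum_i c i z *: p i| <= e].
Proof.
move=> clA cT cTA TC [q0 Cq0] e0.
have e2 : 0 < e / 2 by rewrite divr_gt0.
have [k [q [qA qnet]]] := compact_net cTA e2.
have ext i : exists g : Z -> R, continuous (g : Z -> R^o) /\
    forall z, A z -> g z = Num.max 0 (e - `|T z - q i|).
  have [||g [gE cg _]] := continuous_bounded_extension
      (@pseudometric_normal R Z) clA
      (f := fun z => Num.max 0 (e - `|T z - q i|)) e0.
  - apply: (@cts_max R (subspace A)); first exact: cts_cst.
    apply: (@ctsB _ R^o); first exact: cts_cst.
    by apply: cts_norm; apply: ctsB => //; exact: cts_cst.
  - move=> z Az; rewrite ger0_norm ?le_max ?lexx// ge_max (ltW e0)/=.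
    by rewrite lerBlDr lerDl.
  by exists g; split=> // z Az; rewrite -gE// inE.
have [g gP] := choice ext.
pose l i z := Num.max 0 (g i z).
have cl i : continuous (l i : Z -> R^o).
  by apply: cts_max; [exact: cts_cst|exact: (gP i).1].
have lA i z : A z -> l i z = Num.max 0 (e - `|T z - q i|).
  by move=> Az; rewrite /l (gP i).2// maxA maxxx.
have l0 i z : 0 <= l i z by rewrite le_max lexx.
(* On [A] the weights add up to at least [e / 2] because the net has mesh [e / 2], so [s] is their
   sum there. Off [A] the maximum keeps the denominator positive, and the mass then missing goes to
   [q0]. *)
pose s z := Num.max (e / 2) (\sum_i l i z).
have cs : continuous (s : Z -> R^o).
  by apply: cts_max; [exact: cts_cst|exact: (continuous_sum cl)].
have s0 z : 0 < s z by rewrite lt_max e2.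
have sA z : A z -> s z = \sum_i l i z.
  move=> Az; apply/max_idPr; have [i qi] := qnet (T z) (imageP T Az).
  rewrite (bigD1 i)//= lA// -[leLHS]addr0 lerD ?sumr_ge0// le_max.
  by apply/orP; right; lra.
pose m i z := l i z / s z.
have cm i : continuous (m i : Z -> R^o).
  by apply: ctsM => //; apply: ctsV => // z; rewrite gt_eqF.
have m0 i z : 0 <= m i z by rewrite divr_ge0// ltW.
have m1 z : \sum_i m i z <= 1.
  by rewrite -mulr_suml ler_pdivrMr// mul1r le_max lexx orbT.
have mA z : A z -> \sum_i m i z = 1.
  by move=> Az; rewrite -mulr_suml -sA// divff// gt_eqF.
exists k.+1,
  (fun i z => if unlift ord0 i is Some j then m j z else 1 - \sum_j m j z),
  (fun i => if unlift ord0 i is Some j then q j else q0); split.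
- move=> i; case: unliftP => [j _|_]; first exact: cm.
  by apply: (@ctsB _ R^o); [exact: cts_cst|exact: (continuous_sum cm)].
- by move=> i z; case: unliftP => [j _|_]; rewrite ?subr_ge0.
- move=> z; rewrite big_ord_recl unlift_none.
  rewrite [X in _ + X](eq_bigr (fun j => m j z)) ?subrK// => j _.
  by rewrite liftK.
- by move=> i; case: unliftP => [j _|_] //; exact/TC/qA.
move=> z Az; rewrite big_ord_recl unlift_none mA// subrr scale0r add0r.
under eq_bigr do rewrite liftK.
rewrite -[X in X - _]scale1r -(mA z Az) scaler_suml -sumrB.
rewrite (le_trans (ler_norm_sum _ _ _))// -[leRHS]mul1r -(mA z Az) mulr_suml.
apply: ler_sum => i _; rewrite -scalerBr normrZ ger0_norm//.
have [->|lz] := eqVneq (m i z) 0; first by rewrite !mul0r.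
rewrite ler_wpM2l// -subr_ge0 leNgt; apply/negP => neg; move/negP: lz; apply.
by rewrite /m lA// max_l ?mul0r// ltW.
Qed.

(** * Operations preserving finite rank *)

Section finite_rank.
Context {R : realType} {S : topologicalType} {W : normedModType R}.
Implicit Types (f g : S -> W) (s : S -> R).

Lemma finite_rank_continuous f : finite_rank f -> continuous f.
Proof.
move=> [k [c [p [b [cc _ fE]]]]]; have -> : f = fun z => \sum_i c i z *: p i.
  exact/funext.
by apply: continuous_sum => i; apply: ctsZ; [exact: cc|exact: cts_cst].
Qed.

Lemma finite_rank_bounded f : finite_rank f -> exists B, forall z, `|f z| <= B.
Proof.
move=> [k [c [p [b [_ cb fE]]]]]; exists (\sum_i b * `|p i|) => z.
rewrite fE (le_trans (ler_norm_sum _ _ _))// ler_sum// => i _.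
by have /andP[c0 c1] := cb i z; rewrite normrZ ger0_norm// ler_wpM2r.
Qed.

Lemma finite_rank_cst (w : W) : finite_rank (fun _ : S => w).
Proof.
exists 1%N, (fun _ _ => 1), (fun _ => w), 1; split=> [i|i z|z].
- exact: cts_cst.
- by rewrite ler01 lexx.
- by rewrite big_ord1 scale1r.
Qed.

Lemma finite_rankD f g : finite_rank f -> finite_rank g ->
  finite_rank (fun z => f z + g z).
Proof.
move=> [k [c [p [b [cc cb fE]]]]] [l [d [q [b' [cd db gE]]]]].
exists (k + l)%N,
  (fun i => match fintype.split i with inl j => c j | inr j => d j end),
  (fun i => match fintype.split i with inl j => p j | inr j => q j end),
  (Num.max b b').
split=> [i|i z|z]; first by case: fintype.split.
  case: fintype.split => j; rewrite le_max.
    by have /andP[-> ->] := cb j z.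
  by have /andP[-> ->] := db j z; rewrite orbT.
rewrite big_split_ord fE gE; congr (_ + _); apply: eq_bigr => i _.
  by rewrite (unsplitK (inl i)).
by rewrite (unsplitK (inr i)).
Qed.

Lemma finite_rankZ f s b : finite_rank f -> continuous (s : S -> R^o) ->
  (forall z, 0 <= s z <= b) -> finite_rank (fun z => s z *: f z).
Proof.
move=> [k [c [p [b' [cc cb fE]]]]] cs sb.
exists k, (fun i z => s z * c i z), p, (b * b'); split=> [i|i z|z].
- exact: ctsM.
- have /andP[s0 s1] := sb z; have /andP[c0 c1] := cb i z.
  by rewrite mulr_ge0//= ler_pM.
- by rewrite fE scaler_sumr; apply: eq_bigr => i _; rewrite scalerA.
Qed.

Lemma finite_rank_comp (S' : topologicalType) (g : S' -> S) f : continuous g ->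
  finite_rank f -> finite_rank (f \o g).
Proof.
move=> cg [k [c [p [b [cc cb fE]]]]]; exists k, (fun i => c i \o g), p, b.
split=> [i z|i z|z]; [|exact: cb|exact: fE].
by apply: continuous_comp; [exact: cg|exact: cc].
Qed.

End finite_rank.

Lemma finite_rank_pair (R : realType) (S : topologicalType)
    (W W' : normedModType R) (f : S -> W) (g : S -> W') :
  finite_rank f -> finite_rank g -> finite_rank (fun z => (f z, g z)).
Proof.
move=> [k [c [p [b [cc cb fE]]]]] [l [d [q [b' [cd db gE]]]]].
have -> : (fun z => (f z, g z)) = fun z => (f z, 0) + (0, g z).
  by apply/funext => z; rewrite -[RHS]/(f z + 0, 0 + g z) addr0 add0r.
apply: finite_rankD.
  exists k, c, (fun i => (p i, 0)), b; split=> // z; rewrite fE.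
  rewrite [RHS]surjective_pairing; congr pair.
    by rewrite (big_morph fst (id1 := 0) (op1 := +%R)).
  rewrite (big_morph snd (id1 := 0) (op1 := +%R))// big1// => i _.
  by rewrite /= scaler0.
exists l, d, (fun i => (0, q i)), b'; split=> // z; rewrite gE.
rewrite [RHS]surjective_pairing; congr pair.
  rewrite (big_morph fst (id1 := 0) (op1 := +%R))// big1// => i _.
  by rewrite /= scaler0.
by rewrite (big_morph snd (id1 := 0) (op1 := +%R)).
Qed.

(** If no parameter solves the equation at [z0], compactness of [[0, 1]] gives a neighbourhood of
    [z0] good for all parameters at once. Closedness is what allows this set in Urysohn's lemma. *)
Lemma closed_segment_fixpoints (R : realType) (Z : normedModType R) (S : set Z)
    (f : R * Z -> Z) :
  closed S -> continuous f ->
  closed [set z | S z /\ exists2 t, 0 <= t <= 1 & f (t, z) = z].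
Proof.
move=> cS cf; rewrite -openC openE => z0 /= nz0.
have [Sz0|nS] := pselect (S z0); last first.
  have : open (~` S) by rewrite openC.
  by rewrite openE => /(_ _ nS); apply: filterS => z /= nSz [].
have : \forall z \near z0, `[0, 1]%classic `<=` (fun t => f (t, z) <> z).
  apply: (iffLR (compact_near_coveringP _)) (@segment_compact R 0 1) _ _ _ _ _.
  move=> t /=; rewrite in_itv/= => t01.
  have fz0 : f (t, z0) - z0 <> 0.
    move=> /eqP; rewrite subr_eq0 => /eqP fz0; apply: nz0.
    by split=> //; exists t.
  have cd : continuous (fun u : R * Z => f u - u.2).
    by apply: ctsB => // u; exact: cvg_snd.
  have : open [set u : R * Z | 0 < `|f u - u.2|].
    apply: (@open_comp _ _ _ [set y : R | 0 < y]) => [u _|].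
      exact: (cts_norm cd).
    exact: open_gt.
  rewrite openE => /(_ (t, z0)) /=; rewrite normr_gt0 => /(_ (introN eqP fz0)).
  by apply: filterS => -[t' z'] /= + fz; rewrite fz subrr normr0 ltxx.
apply: filterS => z h [_ [t t01]]; apply: h; by rewrite /= in_itv.
Qed.

(** * Compression and expansion for maps of finite rank *)

Section core.
Context (R : realType) (X Y : normedModType R).
Variables (K : set X) (D : set Y) (U V Ub Vb : set X) (h : X) (rho : R).
Variables (T1 : X * Y -> X) (T2 : X * Y -> Y).
Hypotheses (clK : closed K) (clD : closed D).
Hypothesis KD : forall x y, K x -> K y -> K (x + y).
Hypothesis KZ : forall (a : R) x, 0 <= a -> K x -> K (a *: x).
Hypotheses (Kh : K h) (h0 : h != 0).
Hypotheses (clUb : closed Ub) (clVb : closed Vb).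
Hypotheses (clU : closed (K `\` U)) (clV : closed (K `\` V)).
Hypotheses (VVb : V `<=` Vb) (VbU : Vb `<=` U) (UUb : U `<=` Ub).
Hypothesis UbK : Ub `<=` K.
Hypothesis V0 : V 0.
Hypothesis Ub_le : forall x, Ub x -> `|x| <= rho.
Hypotheses (frT1 : finite_rank T1) (frT2 : finite_rank T2).
Hypotheses (KT1 : forall z, K (T1 z)) (DT2 : forall z, D (T2 z)).

Let A := [set z : X * Y | [/\ Ub z.1, ~ V z.1 & D z.2]].

Hypothesis nofix : forall z, A z -> (T1 z, T2 z) <> z.

Let clA : closed A.
Proof.
have -> : A = [set z | Ub z.1] `&` [set z | (K `\` V) z.1] `&` [set z | D z.2].
  apply/seteqP; split=> z /=; last by move=> [[? [? ?]] ?]; split.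
  by move=> [? ? ?]; do 3 split=> //; exact: UbK.
apply: closedI; [apply: closedI|].
- by apply: closed_preimage clUb; exact/cts_fst/cts_id.
- by apply: closed_preimage clV; exact/cts_fst/cts_id.
- by apply: closed_preimage clD; exact/cts_snd/cts_id.
Qed.

(** Translation by [M *: h] is then too long for a solution when [B] bounds the distance between a
    solution and its untranslated image. *)
Let large (B : R) : exists2 M, 0 <= M & B < M * `|h|.
Proof.
exists ((`|B| + 1) / `|h|); first by rewrite divr_ge0// addr_ge0.
by rewrite divfK ?normr_eq0// ltr_pwDr// ler_norm.
Qed.

Let cT1 : continuous T1. Proof. exact: finite_rank_continuous. Qed.
Let cT2 : continuous T2. Proof. exact: finite_rank_continuous. Qed.

Let ctT1 : continuous (fun u : R * (X * Y) => T1 u.2).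
Proof. by apply: cts_comp => //; exact/cts_snd/cts_id. Qed.
Let ctT2 : continuous (fun u : R * (X * Y) => T2 u.2).
Proof. by apply: cts_comp => //; exact/cts_snd/cts_id. Qed.
Let ct1 : continuous (fun u : R * (X * Y) => u.1).
Proof. exact/cts_fst/cts_id. Qed.

Lemma compression
  (bV : forall z (mu : R), Vb z.1 -> ~ V z.1 -> D z.2 -> 0 <= mu ->
     (T1 z + mu *: h, T2 z) <> z)
  (bU : forall z (t : R), Ub z.1 -> ~ U z.1 -> D z.2 -> 0 <= t <= 1 ->
     (t *: T1 z, T2 z) <> z) : False.
Proof.
have [B BT1] := finite_rank_bounded frT1.
have [M M0 MB] := large (rho + B).
(* All solutions in [Vb] of the translation homotopy, run up to the full length [M]. Since [phi] is
   1 on them, a fixed point of the map with parameter [phi] undergoes the whole translation. *)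
pose SV := [set z : X * Y | (Vb z.1 /\ D z.2) /\
  exists2 t, 0 <= t <= 1 & (T1 z + (t * M) *: h, T2 z) = z].
have clSV : closed SV.
  apply: (@closed_segment_fixpoints R (X * Y)%type _
      (fun u => (T1 u.2 + (u.1 * M) *: h, T2 u.2))).
    apply: closedI.
      by apply: closed_preimage clVb; exact/cts_fst/cts_id.
    by apply: closed_preimage clD; exact/cts_snd/cts_id.
  apply: cts_pair => //; apply: ctsD => //; apply: ctsZ; last exact: cts_cst.
  by apply: ctsM => //; exact: cts_cst.
have [|phi [cphi phi01 phiA phiS]] := urysohn_metric clA clSV.
  rewrite -subset0 => z [[_ nV _] [[? ?] [t /andP[t0 _]]]].
  by apply: bV => //; rewrite mulr_ge0.
pose N1 z := T1 z + phi z *: (M *: h).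
have frN1 : finite_rank N1.
  apply: finite_rankD => //; apply: finite_rankZ phi01 => //.
  exact: finite_rank_cst.
have cN1 := finite_rank_continuous frN1.
have KN1 z : K (N1 z).
  by have /andP[? _] := phi01 z; apply: KD => //; do 2 apply: KZ => //.
have N1A z : A z -> N1 z = T1 z.
  by move=> Az; rewrite /N1 phiA// scale0r addr0.
pose SU := [set z : X * Y | (Ub z.1 /\ D z.2) /\
  exists2 t, 0 <= t <= 1 & (t *: N1 z, T2 z) = z].
have clSU : closed SU.
  apply: (@closed_segment_fixpoints R (X * Y)%type _
      (fun u => (u.1 *: N1 u.2, T2 u.2))).
    apply: closedI.
      by apply: closed_preimage clUb; exact/cts_fst/cts_id.
    by apply: closed_preimage clD; exact/cts_snd/cts_id.
  apply: cts_pair => //; apply: ctsZ => //.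
  by apply: cts_comp => //; exact/cts_snd/cts_id.
pose EU := [set z : X * Y | (K `\` U) z.1 /\ D z.2].
have clEU : closed EU.
  apply: closedI.
    by apply: closed_preimage clU; exact/cts_fst/cts_id.
  by apply: closed_preimage clD; exact/cts_snd/cts_id.
have nUV x : ~ U x -> ~ V x by move=> nU /VVb/VbU.
(* A common point lies in [Ub] but not in [U], hence in [A], where [N1] is still [T1]; so [bU]
   forbids it. *)
have [|psi [cpsi psi01 psiE psiS]] := urysohn_metric clEU clSU.
  rewrite -subset0 => z [[[_ nU] Dz] [[Uz _] [t t01]]].
  rewrite N1A; last by split=> //; exact: nUV.
  exact: bU.
have [|z] := @finite_rank_fixpoint R (X * Y)%type
    (fun z => (psi z *: N1 z, T2 z)).
  by apply: finite_rank_pair => //; exact: finite_rankZ psi01.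
move=> zE; have z1E : psi z *: N1 z = z.1 by rewrite -[in RHS]zE.
have Kz : K z.1 by rewrite -z1E; apply: KZ => //; have /andP[] := psi01 z.
have z2E : T2 z = z.2 by rewrite -[in RHS]zE.
have Dz : D z.2 by rewrite -z2E.
(* Outside [U] the factor [psi] vanishes, which would make [z.1] equal to 0, a point of [U]. *)
have [Uz|nUz] := pselect (U z.1); last first.
  apply: (nUz); rewrite -z1E psiE; last by [].
  by rewrite scale0r; exact/VbU/VVb.
have psi1 : psi z = 1.
  by apply: psiS; split; [split=> //; exact: UUb|exists (psi z)].
rewrite psi1 scale1r in zE z1E.
have [Vz|nVz] := pselect (V z.1); last first.
  have Az : A z by split=> //; exact: UUb.
  by apply: (nofix Az); rewrite -[in RHS]zE N1A.
have phi1 : phi z = 1.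
  apply: phiS; split; [by split=> //; exact: VVb|exists (phi z) => //].
  by rewrite -scalerA.
have : M * `|h| <= rho + B.
  have -> : M * `|h| = `|z.1 - T1 z|.
    by rewrite -z1E /N1 phi1 scale1r addrAC subrr add0r normrZ ger0_norm.
  by rewrite (le_trans (ler_normB _ _))// lerD// Ub_le//; exact: UUb.
by rewrite leNgt MB.
Qed.

(** After the change of variable [ka] the two regions trade places: the complement of [U] surrounds
    0 and is emptied by a long translation, while [V] reaches to infinity and is contracted by
    [1 - phi]. The factor [be] undoes the rescaling, so that fixed points correspond. *)
Lemma expansion (eta : R) (eta0 : 0 < eta)
  (etaV : forall x, K x -> `|x| <= eta -> V x)
  (bV : forall z (t : R), Vb z.1 -> ~ V z.1 -> D z.2 -> 0 <= t <= 1 ->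
     (t *: T1 z, T2 z) <> z)
  (bU : forall z (mu : R), Ub z.1 -> ~ U z.1 -> D z.2 -> 0 <= mu ->
     (T1 z + mu *: h, T2 z) <> z) : False.
Proof.
have rho0 : 0 <= rho.
  by have := Ub_le (UUb (VbU (VVb V0))); rewrite normr0.
pose de := (rho + 1)^-1.
have de0 : 0 < de by rewrite invr_gt0; lra.
pose be (x : X) := Num.max `|x| de ^+ 2.
have m0 (x : X) : 0 < Num.max `|x| de by rewrite lt_max de0 orbT.
have be0 x : 0 < be x by rewrite exprn_gt0.
have cbe : continuous (be : X -> R^o).
  have cm : continuous ((fun x => Num.max `|x| de) : X -> R^o).
    by apply: cts_max; [exact/cts_norm/cts_id|exact: cts_cst].
  exact: ctsM.
pose xi (x : X) := (be x)^-1 *: x.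
have cxi : continuous xi.
  by apply: ctsZ; [apply: ctsV => // x; rewrite gt_eqF|exact: cts_id].
have Kxi x : K x -> K (xi x) by apply: KZ; rewrite invr_ge0 ltW.
have xi_norm x : de <= `|x| -> `|xi x| = `|x|^-1.
  move=> dx; have x0 : `|x| != 0 by rewrite gt_eqF// (lt_le_trans de0).
  rewrite normrZ gtr0_norm ?invr_gt0// /be max_l// expr2 invfM -mulrA mulVf//.
  by rewrite mulr1.
have xi_small x : de <= `|x| -> eta^-1 <= `|x| -> `|xi x| <= eta.
  by move=> dx ex; rewrite xi_norm// invf_ple ?posrE// (lt_le_trans de0).
(* [xi] is the inversion of the cone, truncated so as to be defined near 0.
   It carries the sphere of radius [de] outside [Ub] and large vectors close
   to 0. *)
pose ka (z : X * Y) : X * Y := (xi z.1, z.2).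
have cka : continuous ka.
  apply: cts_pair; last exact/cts_snd/cts_id.
  by apply: cts_comp => //; exact/cts_fst/cts_id.
have clfst (C : set X) : closed C -> closed [set z : X * Y | C z.1].
  by move=> clC; apply: closed_preimage clC; exact/cts_fst/cts_id.
have clDs : closed [set z : X * Y | D z.2].
  by apply: closed_preimage clD; exact/cts_snd/cts_id.
have cn1 : continuous (fun z : X * Y => `|z.1|).
  exact/cts_norm/cts_fst/cts_id.
have nUV x : ~ U x -> ~ V x by move=> nU /VVb/VbU.
pose SV := [set z : X * Y | (Vb z.1 /\ D z.2) /\
  exists2 t, 0 <= t <= 1 & (t *: T1 z, T2 z) = z].
have clSV : closed SV.
  apply: (@closed_segment_fixpoints R (X * Y)%type _
      (fun u => (u.1 *: T1 u.2, T2 u.2))).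
    by apply: closedI => //; exact: clfst.
  by apply: cts_pair => //; exact: ctsZ.
pose EV := [set z : X * Y | (K `\` V) z.1 /\ D z.2].
have clEV : closed EV by apply: closedI => //; exact: clfst.
have clball : closed [set z : X * Y | `|z.1| <= eta].
  exact: closed_preimage (@closed_le _ eta).
have [|phi [cphi phi01 phiE phiS]] := urysohn_metric clEV (closedU clSV clball).
  rewrite -subset0 => z [[[Kz nV] Dz] [[[Vz _] [t t01]]|/= ze]].
    exact: bV.
  exact/nV/etaV.
(* The weight is bounded because [phi (ka z) = 1] as soon as [z.1] is large. *)
pose s z := (1 - phi (ka z)) * be z.1.
pose L := Num.max de eta^-1.
have cs : continuous (s : _ -> R^o).
  apply: ctsM; last by apply: cts_comp => //; exact/cts_fst/cts_id.
  by apply: (@ctsB _ R^o); [exact: cts_cst|exact: (cts_comp cphi cka)].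
have ie0 : 0 < eta^-1 by rewrite invr_gt0.
have s0 z : 0 <= s z <= L ^+ 2.
  have /andP[p0 p1] := phi01 (ka z); apply/andP; split.
    by rewrite mulr_ge0 ?subr_ge0// ltW.
  have [zL|Lz] := leP `|z.1| L.
    apply: (@le_trans _ _ (be z.1)).
      by apply: ler_piMl; [exact: ltW|rewrite lerBlDr lerDl].
    apply: lerXn2r; rewrite ?nnegrE; [exact: ltW|by rewrite le_max ltW|].
    by rewrite ge_max zL le_max lexx.
  move: Lz; rewrite gt_max => /andP[dz ez].
  suff -> : s z = 0 by rewrite exprn_ge0// le_max ltW.
  rewrite /s phiS ?subrr ?mul0r//; right.
  by apply: xi_small; exact: ltW.
pose G1 z := s z *: T1 (ka z).
have frG1 : finite_rank G1.
  by apply: finite_rankZ s0 => //; exact: finite_rank_comp cka frT1.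
have cG1 := finite_rank_continuous frG1.
have KG1 z : K (G1 z) by apply: KZ => //; have /andP[] := s0 z.
have [B BG1] := finite_rank_bounded frG1.
have [M M0 MB] := large (L + B).
(* The inner region in the new variable: a ball, where [xi] is truncated, together with the points
   that [xi] sends outside [U]. It is bounded by [L], since beyond [L] the values of [xi] fall into
   [V]. *)
pose O := [set z : X * Y | (K z.1 /\ D z.2) /\
  (`|z.1| <= de \/ (K `\` U) (xi z.1))].
have clO : closed O.
  apply: closedI; first by apply: closedI => //; exact: clfst.
  apply: closedU; first exact: closed_preimage (@closed_le _ de).
  apply: closed_preimage clU; apply: cts_comp => //; exact/cts_fst/cts_id.
have O_le z : O z -> `|z.1| <= L.
  move=> [[Kz _] [zd|[_ nU]]]; first by rewrite le_max zd.
  rewrite leNgt gt_max; apply/negP => /andP[dz ez].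
  apply/(nUV _ nU)/etaV; first exact: Kxi.
  by apply: xi_small; exact: ltW.
pose SO := [set z : X * Y | O z /\
  exists2 t, 0 <= t <= 1 & (G1 z + (t * M) *: h, T2 (ka z)) = z].
have clSO : closed SO.
  apply: (@closed_segment_fixpoints R (X * Y)%type _
      (fun u => (G1 u.2 + (u.1 * M) *: h, T2 (ka u.2)))) => //.
  have c2 : continuous (fun u : R * (X * Y) => u.2) by exact/cts_snd/cts_id.
  apply: cts_pair; last by apply: cts_comp => //; exact: cts_comp.
  apply: ctsD; first exact: cts_comp.
  by apply: ctsZ; [apply: ctsM => //|]; exact: cts_cst.
pose O' := [set z : X * Y | de <= `|z.1| /\ Ub (xi z.1)].
have clO' : closed O'.
  apply: closedI; first exact: closed_preimage (@closed_ge _ de).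
  apply: closed_preimage clUb; apply: cts_comp => //; exact/cts_fst/cts_id.
(* A common point has norm [de], and then its inverse has norm [rho + 1], too large for [Ub]; or its
   inverse lies in [Ub] outside [U], where [phi] is 0 and dividing the equation by [be z.1]
   contradicts [bU] with [mu = t * M / be z.1]. *)
have [|psi [cpsi psi01 psiE psiS]] := urysohn_metric clO' clSO.
  rewrite -subset0 => z [[dz Uz] [[[Kz Dz] zO] [t /andP[t0 _]]]].
  case: zO => [zd|[_ nUz]].
    have zde : `|z.1| = de by apply/eqP; rewrite eq_le zd.
    move=> _; have := Ub_le Uz; rewrite xi_norm// zde invrK; lra.
  have phi0 : phi (ka z) = 0.
    by apply: phiE; split=> //; split; [exact: UbK|exact: nUV].
  move=> zE; apply: (@bU (ka z) (t * M / be z.1)) => //.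
    by rewrite mulr_ge0 ?mulr_ge0// invr_ge0 ltW.
  have z2E : T2 (ka z) = z.2 by rewrite -[in RHS]zE.
  rewrite [RHS]/ka -z2E.
  have z1E : G1 z + (t * M) *: h = z.1 by rewrite -[in RHS]zE.
  congr pair; rewrite /xi -{3}z1E scalerDr /G1 /s phi0 subr0 mul1r.
  by rewrite !scalerA mulVf ?gt_eqF// scale1r [in LHS]mulrC.
have [|z zE] := @finite_rank_fixpoint R (X * Y)%type
    (fun z => (G1 z + psi z *: (M *: h), T2 (ka z))).
  apply: finite_rank_pair; last exact: finite_rank_comp cka frT2.
  apply: finite_rankD => //; apply: finite_rankZ psi01 => //.
  exact: finite_rank_cst.
have z1E : G1 z + psi z *: (M *: h) = z.1 by rewrite -[in RHS]zE.
have z2E : T2 (ka z) = z.2 by rewrite -[in RHS]zE.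
have /andP[psi0 psi1] := psi01 z.
have Kz : K z.1 by rewrite -z1E; apply: KD => //; do 2 apply: KZ => //.
have Dz : D z.2 by rewrite -z2E.
have [zO|nzO] := pselect (O z).
  have psiz : psi z = 1.
    by apply: psiS; split=> //; exists (psi z); rewrite ?psi0// -scalerA.
  have : M * `|h| <= L + B.
    have -> : M * `|h| = `|z.1 - G1 z|.
      by rewrite -z1E psiz scale1r addrAC subrr add0r normrZ ger0_norm.
    by rewrite (le_trans (ler_normB _ _))// lerD// O_le.
  by rewrite leNgt MB.
have dz : de < `|z.1|.
  by rewrite ltNge; apply/negP => zd; apply: nzO; split=> //; left.
have Uz : U (xi z.1).
  apply: contrapT => nU; apply: nzO; split=> //; right; split=> //.
  exact: Kxi.
have z1 : z.1 = G1 z.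
  by rewrite -z1E psiE ?scale0r ?addr0//; split; [exact: ltW|exact: UUb].
have xiE : xi z.1 = (1 - phi (ka z)) *: T1 (ka z).
  by rewrite /xi {2}z1 /G1 scalerA /s mulrC mulfK// gt_eqF.
have [Vz|nVz] := pselect (V (xi z.1)); last first.
  have phi0 : phi (ka z) = 0 by apply: phiE; split=> //; split=> //; exact: Kxi.
  have Az : A (ka z) by split=> //; exact: UUb.
  by apply: (nofix Az); rewrite z2E [RHS]/ka xiE phi0 subr0 scale1r.
have phi1 : phi (ka z) = 1.
  apply: phiS; left; split; first by split=> //; exact: VVb.
  exists (1 - phi (ka z)); last by rewrite z2E -xiE.
  have /andP[? ?] := phi01 (ka z); rewrite subr_ge0 lerBlDr lerDl.
  exact/andP.
(* This is where the spurious fixed point disappears: contraction to 0 is incompatible with [z.1]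
   being longer than [de]. *)
have : z.1 = 0 by rewrite z1 /G1 /s phi1 subrr mul0r scale0r.
by move=> z10; move: dz; rewrite z10 normr0 ltNge ltW.
Qed.
End core.

(** [S] need not be compact, so the covering argument runs over parameters and values of [T], that
    is over [[0, M]] times the closure of the image. A value [w] near [w0] with parameter near [t0]
    determines its candidate solution [G (t, w)], which is close to [G (t0, w0)]. *)
Lemma fixpoint_free_stable (R : realType) (Z W : normedModType R) (A S : set Z)
    (T : Z -> W) (G : R * W -> Z) (M : R) :
  closed S -> S `<=` A -> {within A, continuous T} ->
  compact (closure (T @` A)) -> continuous G ->
  (forall z t, S z -> 0 <= t <= M -> G (t, T z) <> z) ->
  \forall e \near (0 : R)^'+, forall z t w, S z -> 0 <= t <= M ->
    `|T z - w| <= e -> G (t, w) <> z.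
Proof.
move=> clS SA cT cTA cG nofix.
pose P (e : R) (u : R * W) := forall z w, S z -> T z = u.2 ->
  `|u.2 - w| <= e -> G (u.1, w) <> z.
have : \forall e \near (0 : R)^'+,
    `[0, M]%classic `*` closure (T @` A) `<=` P e.
  apply: (iffLR (compact_near_coveringP _)) _ _ _ _ _ _.
    exact: compact_setX (@segment_compact R 0 M) cTA.
  move=> [t0 w0] [/=]; rewrite in_itv/= => t01 _.
  (* Either [G (t0, w0)] is outside the closed set [S], and so are nearby points, or [T] takes there
     a value other than [w0], and by continuity stays a distance [d] away from [w0] at nearby points
     of [S]. *)
  have [d d0 Nd] : exists2 d, 0 < d &
      \forall z \near G (t0, w0), S z -> d <= `|w0 - T z|.
    have [Sz0|nS] := pselect (S (G (t0, w0))); last first.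
      exists 1 => //; have : open (~` S) by rewrite openC.
      by rewrite openE => /(_ _ nS); apply: filterS.
    set z0 := G (t0, w0) in Sz0 *.
    have Tz0 : T z0 != w0.
      by apply/eqP => Tz0; apply: (nofix z0 t0) => //; rewrite Tz0.
    have d0 : 0 < `|w0 - T z0| / 2.
      by rewrite divr_gt0// normr_gt0 subr_eq0 eq_sym.
    exists (`|w0 - T z0| / 2) => //.
    have /cvgrPdist_lt /(_ _ d0) :=
      (iffLR (subspace_continuousP A T) cT) z0 (SA _ Sz0).
    rewrite near_withinE; apply: filterS => z Tz Sz; have := Tz (SA _ Sz).
    have := ler_normD (w0 - T z) (T z - T z0).
    rewrite addrA subrK [`|T z - T z0|]distrC; lra.
  have /nbhs_ballP[r /= r0 rN] := cG (t0, w0) _ Nd.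
  have r2 : 0 < r / 2 by rewrite divr_gt0.
  near=> u e => z w Sz Tz wu Gz.
  have uu0 : ball (t0, w0) (Num.min (r / 2) d) u.
    by near: u; apply: nbhsx_ballx; rewrite lt_min r2 d0.
  have er : e < r / 2 by near: e; exact: nbhs_right_lt.
  move: uu0 => [/=]; rewrite -!ball_normE/= !lt_min.
  move=> /andP[t0r _] /andP[w0r w0d].
  have := rN (u.1, w); rewrite /preimage/= Gz => /(_ _ Sz); rewrite Tz.
  move=> /(_ _)/wrap[|]; last by rewrite leNgt w0d.
  split=> /=; rewrite -ball_normE/=; first by lra.
  have := ler_normD (w0 - u.2) (u.2 - w); rewrite addrA subrK.
  by move: wu => /=; lra.
apply: filter_app; near=> e => QP z t w Sz t01 Tw.
have := QP (t, T z); apply => //; split=> /=; first by rewrite in_itv.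
by apply: subset_closure; exists z => //; exact: SA.
Unshelve. all: by end_near. Qed.

(** * Reduction to maps of finite rank *)

Section relative_topology.
Context {T : topologicalType} {K : set T}.
Implicit Types U V : set T.

Lemma sub_rel_closure U : U `<=` rel_closure K U.
Proof. exact: (@subset_closure (subspace K)). Qed.

Lemma rel_closure_sub U : U `<=` K -> rel_closure K U `<=` K.
Proof. by move=> UK; rewrite /rel_closure closure_subspaceW// => x []. Qed.

Lemma closed_rel_closure U : closed K -> U `<=` K -> closed (rel_closure K U).
Proof.
move=> cK UK; rewrite /rel_closure closure_subspaceW//; apply: closedI => //.
exact: closed_closure.
Qed.

Lemma rel_closure_sub_closed U C : U `<=` K -> closed C -> U `<=` C ->
  rel_closure K U `<=` C.
Proof.
move=> UK cC UC; rewrite /rel_closure closure_subspaceW// => x [+ _].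
by rewrite [X in _ -> X x](closure_id C).1//; exact: closureS.
Qed.

Lemma rel_boundaryI U x : rel_closure K U x -> ~ U x -> rel_boundary K U x.
Proof. by move=> Ux nUx; split=> // /interior_subset. Qed.

Lemma closedD_rel_open C U : closed C -> C `<=` K -> rel_open K U ->
  closed (C `\` U).
Proof.
move=> cC CK [UK /open_subspaceP[W oW WK]].
have -> : C `\` U = C `&` ~` W; last first.
  by apply: closedI => //; exact: open_closedC.
apply/seteqP; split=> x [Cx nx]; split=> // Hx; apply: nx.
  by have [] : (U `&` K) x by rewrite -WK; split=> //; exact: CK.
by have [] : (W `&` K) x by rewrite WK; split=> //; exact: CK.
Qed.

End relative_topology.

Lemma rel_open_ball (R : realType) (X : normedModType R) (K V : set X) :
  rel_open K V -> V 0 -> exists2 eta : R, 0 < eta &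
    forall x, K x -> `|x| <= eta -> V x.
Proof.
move=> [VK /open_subspaceP[W oW WK]] V0.
have W0 : W 0 by have [] : (W `&` K) 0 by rewrite WK; split=> //; exact: VK.
have /nbhs_ballP[r /= r0 rW] : nbhs (0 : X) W by apply: open_nbhs_nbhs.
exists (r / 2); first by rewrite divr_gt0.
move=> x Kx xr; have [] // : (V `&` K) x.
rewrite -WK; split=> //; apply: rW; rewrite -ball_normE/= sub0r normrN; lra.
Qed.

Lemma cone_add (R : realType) (X : normedModType R) (K : set X) (x y : X) :
  is_cone K -> K x -> K y -> K (x + y).
Proof.
move=> [_ /convex_setE cK KZ _] Kx Ky.
have h01 : 0 <= (2^-1 : R) <= 1 by lra.
have h2 : 1 - (2^-1 : R) = 2^-1 by lra.
have := KZ _ 2 (cK _ _ _ Kx Ky h01); rewrite h2 -scalerDr scalerA mulfV//.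
by rewrite scale1r; exact.
Qed.

Lemma norm_fst (R : realType) (X Y : normedModType R) (z : X * Y) :
  `|z.1| <= `|z|.
Proof. by rewrite prod_normE le_max lexx. Qed.

(** * Stability of the two boundary conditions *)

Section boundary.
Context (R : realType) (X Y : normedModType R).
Variables (A S : set X) (D : set Y) (T : X * Y -> X * Y).
Hypotheses (clS : closed S) (clD : closed D) (SA : S `<=` A).
Hypothesis cT : {within A `*` D, continuous T}.
Hypothesis cTA : compact (closure (T @` (A `*` D))).
Hypothesis nofix : forall z, (A `*` D) z -> T z <> z.

Let clSD : closed (S `*` D). Proof.
by apply: closedI; [apply: closed_preimage clS|apply: closed_preimage clD];
  [exact/cts_fst/cts_id|exact/cts_snd/cts_id].
Qed.
Let SAD : S `*` D `<=` A `*` D. Proof. by move=> z [/SA]. Qed.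

(** For [t] strictly between 0 and 1 a solution violates the condition with [lambda = t^-1]; [t = 1]
    would be a fixed point of [T], and [t = 0] would put 0 in [S]. *)
Lemma radial_stable : ~ S 0 ->
  (forall z (lambda : R), (S `*` D) z -> 1 < lambda ->
    (T z).1 <> lambda *: z.1) ->
  \forall e \near (0 : R)^'+, forall z t w, (S `*` D) z -> 0 <= t <= 1 ->
    `|T z - w| <= e -> (t *: w.1, w.2) <> z.
Proof.
move=> S0 bT.
apply: (fixpoint_free_stable (G := fun u : R * (X * Y) => (u.1 *: u.2.1, u.2.2))
  clSD SAD cT cTA).
  apply: cts_pair; last exact/cts_snd/cts_snd/cts_id.
  by apply: ctsZ; [exact/cts_fst/cts_id|exact/cts_fst/cts_snd/cts_id].
move=> z t SDz /andP[t0 t1] /= zE.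
have z1E : t *: (T z).1 = z.1 by rewrite -[in RHS]zE.
have z2E : (T z).2 = z.2 by rewrite -[in RHS]zE.
have [tz|tn0] := eqVneq t 0.
  by apply: S0; have [+ _] := SDz; rewrite -z1E tz scale0r.
have [tz|tn1] := eqVneq t 1.
  apply: (nofix (SAD SDz)); rewrite [LHS]surjective_pairing z2E.
  by rewrite -[(T z).1]scale1r -tz z1E -surjective_pairing.
apply: (bT z t^-1) => //; last by rewrite -z1E scalerA mulVf// scale1r.
by rewrite invf_gt1// lt_neqAle ?tn1// eq_sym tn0.
Qed.

(** The parameter [mu] ranges over an unbounded set, but a solution has [mu * |h|] bounded by the
    sizes of [z.1] and [w.1], so the compact range [[0, M]] suffices. *)
Lemma translation_stable (h : X) (rho : R) : h != 0 ->
  (forall x, S x -> `|x| <= rho) ->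
  (forall z (mu : R), (S `*` D) z -> 0 < mu -> (T z).1 + mu *: h <> z.1) ->
  \forall e \near (0 : R)^'+, forall z mu w, (S `*` D) z -> 0 <= mu ->
    `|T z - w| <= e -> (w.1 + mu *: h, w.2) <> z.
Proof.
move=> h0 Srho bT.
have [B BT] : exists B : R, forall z, (A `*` D) z -> `|T z| <= B.
  have [B [_ BT]] := compact_bounded cTA; exists (B + 1) => z Az.
  by apply: BT; [rewrite ltrDl|apply: subset_closure; exists z].
have nh : 0 < `|h| by rewrite normr_gt0.
(* [rho] bounds [z.1], [B] bounds [T z], and 1 covers the error, as [e] is taken at most 1. *)
pose M := (rho + B + 1) / `|h|.
have stable : \forall e \near (0 : R)^'+, forall z t w, (S `*` D) z ->
    0 <= t <= M -> `|T z - w| <= e -> (w.1 + t *: h, w.2) <> z.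
  apply: (fixpoint_free_stable
    (G := fun u : R * (X * Y) => (u.2.1 + u.1 *: h, u.2.2)) clSD SAD cT cTA).
    apply: cts_pair; last exact/cts_snd/cts_snd/cts_id.
    apply: ctsD; first exact/cts_fst/cts_snd/cts_id.
    by apply: ctsZ; [exact/cts_fst/cts_id|exact: cts_cst].
  move=> z t SDz /andP[t0 t1] /= zE.
  have z1E : (T z).1 + t *: h = z.1 by rewrite -[in RHS]zE.
  have z2E : (T z).2 = z.2 by rewrite -[in RHS]zE.
  have [tz|tn0] := eqVneq t 0; last first.
    by apply: (bT z t) => //; rewrite lt_neqAle eq_sym tn0.
  apply: (nofix (SAD SDz)); rewrite [LHS]surjective_pairing z2E.
  by rewrite -[(T z).1]addr0 -(scale0r h) -tz z1E -surjective_pairing.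
near=> e => z mu w SDz mu0 Tw zE.
have muM : mu <= M.
  rewrite ler_pdivlMr//.
  have -> : mu * `|h| = `|z.1 - w.1|.
    have <- : w.1 + mu *: h = z.1 by rewrite -[in RHS]zE.
    by rewrite addrAC subrr add0r normrZ ger0_norm.
  rewrite (le_trans (ler_normB _ _))// -addrA lerD ?Srho//; first by case: SDz.
  rewrite (le_trans (norm_fst w))//.
  have -> : w = T z - (T z - w) by rewrite subKr.
  rewrite (le_trans (ler_normB _ _))// lerD ?BT//; first exact: SAD.
  by rewrite (le_trans Tw)//; near: e; exact: nbhs_right_le.
move: zE; apply: (near stable e) => //.
by rewrite mu0.
Unshelve. all: by end_near. Qed.
End boundary.

(** Both components share the coefficients of one convex combination of points of [K] times [D]. *)
Lemma finite_rank_approx (R : realType) (X Y : normedModType R) (K : set X)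
    (D : set Y) (A : set (X * Y)) (T : X * Y -> X * Y) (e : R) :
  K 0 -> (forall x y, K x -> K y -> K (x + y)) ->
  (forall (a : R) x, 0 <= a -> K x -> K (a *: x)) ->
  convex D -> D !=set0 -> closed A -> {within A, continuous T} ->
  compact (closure (T @` A)) -> T @` A `<=` K `*` D -> 0 < e ->
  exists (T1 : X * Y -> X) (T2 : X * Y -> Y),
    [/\ finite_rank T1, finite_rank T2, forall z, K (T1 z), forall z, D (T2 z) &
      forall z, A z -> `|T z - (T1 z, T2 z)| <= e].
Proof.
move=> K0 KD KZ cD [d Dd] clA cT cTA TKD e0.
have KD0 : (K `*` D) !=set0 by exists (0, d).
have [k [c [p [cc c0 c1 Cp Tc]]]] := compact_approx clA cT cTA TKD KD0 e0.
have c01 i z : 0 <= c i z <= 1.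
  rewrite c0/= -(c1 z) (bigD1 i)//= lerDl; exact: sumr_ge0.
exists (fun z => \sum_i c i z *: (p i).1), (fun z => \sum_i c i z *: (p i).2).
split.
- by exists k, c, (fun i => (p i).1), 1.
- by exists k, c, (fun i => (p i).2), 1.
- move=> z; apply: (big_ind (fun x => K x)) => // i _.
  by apply: KZ => //; exact: (Cp i).1.
- by move=> z; apply: convex_sum => // i; exact: (Cp i).2.
move=> z Az; have := Tc z Az; congr (`|_ - _| <= e).
rewrite [LHS]surjective_pairing; congr pair.
  by rewrite (big_morph fst (id1 := 0) (op1 := +%R)).
by rewrite (big_morph snd (id1 := 0) (op1 := +%R)).
Qed.

Theorem theorem2p4 (R : realType) (X Y : completeNormedModType R)
  (K1 U V : set X) (D : set Y) (T : X * Y -> X * Y)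
  (hK1 : is_cone K1)
  (hUbnd : bounded_set U) (hUopen : rel_open K1 U)
  (hVbnd : bounded_set V) (hVopen : rel_open K1 V)
  (h0V : V 0) (hVU : rel_closure K1 V `<=` U)
  (hD0 : D !=set0) (hDclosed : closed D) (hDconvex : convex_set D)
  (hT : compact_map ((rel_closure K1 U `\` V) `*` D) (K1 `*` D) T)
  (hyp : exists h : X, [/\ K1 h, h <> 0 &
    (forall u : X * Y, ((rel_closure K1 U `\` V) `*` D) u ->
       (forall mu : R, rel_boundary K1 V u.1 -> 0 < mu ->
          (T u).1 + mu *: h <> u.1) /\
       (forall lambda : R, rel_boundary K1 U u.1 -> 1 < lambda ->
          (T u).1 <> lambda *: u.1))
    \/
    (forall u : X * Y, ((rel_closure K1 U `\` V) `*` D) u ->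
       (forall lambda : R, rel_boundary K1 V u.1 -> 1 < lambda ->
          (T u).1 <> lambda *: u.1) /\
       (forall mu : R, rel_boundary K1 U u.1 -> 0 < mu ->
          (T u).1 + mu *: h <> u.1))]) :
  exists u : X * Y,
    [/\ (K1 `*` D) u, (rel_closure K1 U `\` V) u.1 & T u = u].
Proof.
have [h [Kh /eqP h0 hyps]] := hyp.
have [clK _ KZ' _] := hK1; have [UK _] := hUopen; have [VK _] := hVopen.
have KZ (a : R) x : 0 <= a -> K1 x -> K1 (a *: x) by move=> ? ?; exact: KZ'.
have KD x y : K1 x -> K1 y -> K1 (x + y) by exact: cone_add.
have [TKD cT] := hT; rewrite precompactE => cTA.
set Ub := rel_closure K1 U in hyps TKD cT cTA *.
set Vb := rel_closure K1 V in hVU.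
have UUb : U `<=` Ub  by exact: sub_rel_closure.
have VVb : V `<=` Vb  by exact: sub_rel_closure.
have UbK : Ub `<=` K1  by exact: rel_closure_sub.
have clUb : closed Ub by exact: closed_rel_closure.
have clVb : closed Vb by exact: closed_rel_closure.
have clU : closed (K1 `\` U) by exact: closedD_rel_open hUopen.
have clV : closed (K1 `\` V) by exact: closedD_rel_open hVopen.
have [rho Ub_le] : exists rho : R, forall x, Ub x -> `|x| <= rho.
  have [M [_ UM]] := hUbnd; exists (M + 1); apply: rel_closure_sub_closed => //.
    exact: closed_preimage (cts_norm cts_id) (@closed_le _ (M + 1)).
  by move=> x Ux; apply: UM => //; rewrite ltrDl.
have [eta eta0 etaV] := rel_open_ball hVopen h0V.
apply: contrapT => nofix'.
have nofix z : ((Ub `\` V) `*` D) z -> T z <> z.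
  move=> [Uz Dz] Tz; apply: nofix'; exists z; split=> //; split=> //.
  exact: UbK Uz.1.
have clA : closed (Ub `\` V) by exact: closedD_rel_open hVopen.
have clbV : closed (Vb `\` V).
  by apply: closedD_rel_open hVopen => // x /hVU; exact: UK.
have clbU : closed (Ub `\` U) by exact: closedD_rel_open hUopen.
have bVA : Vb `\` V `<=` Ub `\` V by move=> x [/hVU/UUb].
have bUA : Ub `\` U `<=` Ub `\` V by move=> x [? nU]; split=> // /VVb/hVU.
have clAD : closed ((Ub `\` V) `*` D).
  apply: closedI; first by apply: closed_preimage clA; exact/cts_fst/cts_id.
  by apply: closed_preimage hDclosed; exact/cts_snd/cts_id.
have bVrb z : ((Vb `\` V) `*` D) z -> rel_boundary K1 V z.1.
  by move=> [[? ?] _]; exact: rel_boundaryI.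
have bUrb z : ((Ub `\` U) `*` D) z -> rel_boundary K1 U z.1.
  by move=> [[? ?] _]; exact: rel_boundaryI.
have bVle x : (Vb `\` V) x -> `|x| <= rho by move=> /bVA[/Ub_le].
have bUle x : (Ub `\` U) x -> `|x| <= rho by move=> /bUA[/Ub_le].
have bV0 : ~ (Vb `\` V) 0 by move=> [].
have bU0 : ~ (Ub `\` U) 0 by move=> [_]; apply; exact/hVU/VVb.
have SAD C z : C `<=` Ub `\` V -> (C `*` D) z -> ((Ub `\` V) `*` D) z.
  by move=> CA [/CA].
(* Stability of the absence of fixed points itself: the homotopy is constant, with [G = snd] and the
   parameter confined to 0. *)
have A_stable : \forall e \near (0 : R)^'+, forall z (w : X * Y),
    ((Ub `\` V) `*` D) z -> `|T z - w| <= e -> w <> z.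
  have : \forall e \near (0 : R)^'+, forall z (t : R) w,
      ((Ub `\` V) `*` D) z -> 0 <= t <= 0 -> `|T z - w| <= e -> w <> z.
    apply: (fixpoint_free_stable (G := snd) clAD (@subset_refl _ _) cT cTA).
      exact/cts_snd/cts_id.
    by move=> z t Az _; exact: nofix.
  by apply: filterS => e stable z w Az; apply: (stable z 0 w Az); rewrite lexx.
have K0 : K1 0 by exact: VK.
have TKD' : T @` ((Ub `\` V) `*` D) `<=` K1 `*` D.
  by move=> _ [z Az <-]; exact: TKD.
have approx :=
  finite_rank_approx K0 KD KZ (convex_setE hDconvex) hD0 clAD cT cTA TKD'.
case: hyps => bT.
  have bV_stable := translation_stable clbV hDclosed bVA cT cTA nofix h0 bVle
    (fun z mu Sz => (bT z (SAD _ _ bVA Sz)).1 mu (bVrb z Sz)).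
  have bU_stable := radial_stable clbU hDclosed bUA cT cTA nofix bU0
    (fun z la Sz => (bT z (SAD _ _ bUA Sz)).2 la (bUrb z Sz)).
  near (0 : R)^'+ => e.
  have e0 : 0 < e by [].
  have [T1 [T2 [frT1 frT2 KT1 DT2 Te]]] := approx e e0.
  apply: (@compression R X Y K1 D U V Ub Vb h rho T1 T2) => //.
  - move=> z [Uz nVz Dz]; have Az : ((Ub `\` V) `*` D) z by [].
    exact: (near A_stable e _ _ _ Az (Te z Az)).
  - move=> z mu Vz nVz Dz mu0; have Sz : ((Vb `\` V) `*` D) z by [].
    exact: (near bV_stable e _ _ _ _ Sz mu0 (Te z (SAD _ _ bVA Sz))).
  - move=> z t Uz nUz Dz t01; have Sz : ((Ub `\` U) `*` D) z by [].
    exact: (near bU_stable e _ _ _ _ Sz t01 (Te z (SAD _ _ bUA Sz))).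
have bV_stable := radial_stable clbV hDclosed bVA cT cTA nofix bV0
  (fun z la Sz => (bT z (SAD _ _ bVA Sz)).1 la (bVrb z Sz)).
have bU_stable := translation_stable clbU hDclosed bUA cT cTA nofix h0 bUle
  (fun z mu Sz => (bT z (SAD _ _ bUA Sz)).2 mu (bUrb z Sz)).
near (0 : R)^'+ => e.
have e0 : 0 < e by [].
have [T1 [T2 [frT1 frT2 KT1 DT2 Te]]] := approx e e0.
apply: (expansion clK hDclosed KD KZ Kh h0 clUb clVb clU clV VVb hVU UUb UbK h0V
  Ub_le frT1 frT2 KT1 DT2 _ eta0 etaV).
- move=> z [Uz nVz Dz]; have Az : ((Ub `\` V) `*` D) z by [].
  exact: (near A_stable e _ _ _ Az (Te z Az)).
- move=> z t Vz nVz Dz t01; have Sz : ((Vb `\` V) `*` D) z by [].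
  exact: (near bV_stable e _ _ _ _ Sz t01 (Te z (SAD _ _ bVA Sz))).
- move=> z mu Uz nUz Dz mu0; have Sz : ((Ub `\` U) `*` D) z by [].
  exact: (near bU_stable e _ _ _ _ Sz mu0 (Te z (SAD _ _ bUA Sz))).
Unshelve. all: by end_near. Qed.
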